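(* Let $X$ be a complex Hilbert space with open unit ball $B$, let $m$ be an integer with $\dim X\ge m\ge2$, and let $u_1,\dots,u_m\in X$ satisfy $\|u_j\|=1$ for all $j$ and $\langle u_j,u_k\rangle=0$ for $j\ne k$. Let $0\le\alpha<1$. Let $g_1,\dots,g_m\in H(U)$ be locally univalent functions on the unit disk $U$, and let $$\Phi_{u_1,\dots,u_m}(g_1,\dots,g_m)(z)=z-\sum_{j=1}^m\langle z,u_j\rangle u_j+\sum_{j=1}^m g_j(\langle z,u_j\rangle)u_j,\qquad z\in B.$$ (1) If $\Phi_{u_1,\dots,u_m}(g_1,\dots,g_m)\in K(B,\alpha)$, then $g_1,g_2,\dots,g_m\in K(\alpha)$. (2) If $$h(\xi)=\begin{cases}\dfrac{1-(1-\xi)^{2\alpha-1}}{2\alpha-1}, & \alpha\ne\frac12,\\[2mm] -\ln(1-\xi), & \alpha=\frac12,\end{cases}\qquad \xi\in U,$$ then $h\in K(\alpha)$, but $\Phi_{u_1,\dots,u_m}(h,\dots,h)\notin K(B,\alpha)$. (3) $\Phi_{u_1,\dots,u_m}(g_1,\dots,g_m)\in SK(B,\alpha)$ if and only if $g_1,g_2,\dots,g_m\in SK(U,\alpha)$.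
   Context: $X$ is a complex Hilbert space with inner product $\langle\cdot,\cdot\rangle$ (linear in the first variable) and norm $\|\cdot\|$, $B=\{z\in X:\|z\|<1\}$, and $U=\{\xi\in\mathbb{C}:|\xi|<1\}$. $Df(z)$ and $D^2f(z)$ denote the first and second Fréchet derivatives of a holomorphic mapping $f$ at $z$; $I$ is the identity operator on $X$. A holomorphic mapping $f:B\to X$ is locally biholomorphic if every point of $B$ has a neighborhood on which $f$ is biholomorphic (onto its image, with holomorphic inverse); equivalently, $Df(z)$ has a bounded inverse at each $z\in B$. $N(B)$ is the class of all locally biholomorphic mappings $f:B\to X$ with $f(0)=0$ and $Df(0)=I$. For $0\le\alpha<1$, a locally biholomorphic mapping $f:B\to X$ is called a biholomorphic convex mapping of order $\alpha$ on $B$ if $$\|x\|^2-\mathrm{Re}\,\big\langle Df(z)^{-1}D^2f(z)(x,x),z\big\rangle>\alpha\|x\|^2$$ for all $z\in B\setminus\{0\}$ and $x\in X\setminus\{0\}$ with $\mathrm{Re}\,\langle x,z\rangle=0$. $K(B,\alpha)$ is the class of all biholomorphic convex mappings $f$ of order $\alpha$ on $B$ with $f(0)=0$ and $Df(0)=I$. $H(U)$ is the class of analytic functions $f:U\to\mathbb{C}$ with $f(0)=0$, $f'(0)=1$. $K(\alpha)$ is the class of $f\in H(U)$ with $\mathrm{Re}\{1+zf''(z)/f'(z)\}>\alpha$ for all $z\in U$. $SK(B,\alpha)=\{f\in N(B):\|Df(z)^{-1}D^2f(z)(\cdot,\cdot)\|\le1-\alpha\text{ for all }z\in B\}$, where the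 norm is that of a bounded bilinear operator $X\times X\to X$, i.e. the supremum of $\|Df(z)^{-1}D^2f(z)(x,y)\|$ over $\|x\|=\|y\|=1$; and $SK(U,\alpha)=\{f\in H(U): |f''(z)/f'(z)|\le1-\alpha\text{ for all }z\in U\}$. Powers and logarithms of $1-\xi$ use the principal branch. *)

(* Defs.v *)
(* MathComp-Analysis.  The complex numbers are R[i] for R : realType; they are a
   normed module over themselves under the alias R[i]^o, so that 'd, derive1 and
   differentiable over R[i] are the complex (Frechet) derivatives.  Norms in a
   normed module over R[i] take (nonnegative real) values in R[i]; nrm below is
   the same norm with values in R. *)
From HB Require Import structures.
From mathcomp Require Import all_boot all_order all_algebra.
From mathcomp Require Import complex.
From mathcomp Require Import all_classical all_reals all_analysis.

Set Implicit Arguments.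
Unset Strict Implicit.
Unset Printing Implicit Defensive.

Import Order.TTheory GRing.Theory Num.Theory.
Import numFieldNormedType.Exports.

Local Open Scope complex_scope.
Local Open Scope ring_scope.
Local Open Scope classical_set_scope.

Section ComplexFunctions.
Context {R : realType}.
Implicit Types (z a : R[i]) (f : R[i]^o -> R[i]^o).

Definition cexp z : R[i] :=
  (expR (complex.Re z))%:C * (cos (complex.Im z) +i* sin (complex.Im z)).

(* the principal argument, in ]-pi, pi] (for z != 0) *)
Definition carg z : R :=
  let t := acos (complex.Re z / complex.Re `|z|) in
  if 0 <= complex.Im z then t else - t.

Definition clog z : R[i] := ln (complex.Re `|z|) +i* carg z.

Definition cpow z a : R[i] := cexp (a * clog z).

Definition analytic_on (A : set R[i]^o) f :=
  forall z0, A z0 -> exists (c : nat -> R[i]^o) (r : R), 0 < r /\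
    forall z : R[i]^o, `|z - z0| < r%:C ->
      series (fun n => c n * (z - z0) ^+ n) @ \oo --> f z.

Definition locally_univalent (A : set R[i]^o) f :=
  forall z : R[i]^o, A z -> exists2 V, nbhs z V & set_inj (V `&` A) f.

End ComplexFunctions.

Section NormedSpace.
Context {R : realType}.

Definition nrm {X : normedModType R[i]} (x : X) : R := complex.Re `|x|.

Definition unit_ball (X : normedModType R[i]) : set X := [set z | `|z| < 1].

Definition lin_indep {X : lmodType R[i]} m (v : 'I_m -> X) :=
  forall c : 'I_m -> R[i], \sum_j c j *: v j = 0 -> forall j, c j = 0.

Definition dim_ge (X : lmodType R[i]) m := exists v : 'I_m -> X, lin_indep v.

Context {X : normedModType R[i]}.
Implicit Types (A V : set X) (f g : X -> X) (T : X -> X -> X).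

Definition holomorphic_on A f := forall z, A z -> differentiable f z.

Definition biholomorphic_on V f := [/\ holomorphic_on V f, open (f @` V) &
  exists2 g, holomorphic_on (f @` V) g & forall z, V z -> g (f z) = z].

Definition locally_biholomorphic A f :=
  forall z, A z ->
    exists V, [/\ open V, V z, V `<=` A & biholomorphic_on V f].

(* T is the Frechet derivative at z of the map w |-> 'd f w with values in the
   bounded operators under the operator norm, bounded operators from X to these
   being identified with bounded bilinear maps; T x y = (D('d f)(z) x) y. *)
Definition is_second_diff f (z : X) T := [/\
  (forall y, linear (T^~ y)), (forall x, linear (T x)),
  (exists M : R, forall x y, nrm (T x y) <= M * nrm x * nrm y) &
  forall e : R, 0 < e -> \forall h \near (0 : X), forall y,
    nrm ('d f (z + h) y - 'd f z y - T h y) <= e * nrm h * nrm y].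

Definition second_diff f (z : X) : X -> X -> X :=
  xget (fun _ _ => 0) [set T | is_second_diff f z T].

Definition inv_diff f (z v : X) : X := xget 0 [set w | 'd f z w = v].

(* extended-real valued, so that it is +oo when T is unbounded *)
Definition bilin_norm T : \bar R :=
  ereal_sup [set r | exists x y : X,
    [/\ nrm x = 1, nrm y = 1 & r = (nrm (T x y))%:E]].

End NormedSpace.
Arguments unit_ball {R} X z.

Section Classes.
Context {R : realType}.
Implicit Types (alpha : R) (f : R[i]^o -> R[i]^o).

Definition U : set R[i]^o := unit_ball R[i]^o.

Definition classHU f := [/\ analytic_on U f, f 0 = 0 & derive1 f 0 = 1].

(* f' must not vanish for f''/f' to be defined; in Rocq x / 0 = 0. *)
Definition classK alpha f := classHU f /\
  forall z, U z -> derive1 f z != 0 /\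
    alpha < complex.Re (1 + z * derive1n 2 f z / derive1 f z).

Definition classSKU alpha f := classHU f /\
  forall z, U z -> derive1 f z != 0 /\
    nrm (derive1n 2 f z / derive1 f z) <= 1 - alpha.

Context {X : normedModType R[i]}.
Implicit Types (ip : X -> X -> R[i]) (F : X -> X).

Definition is_normalized F := F 0 = 0 /\ forall x, 'd F 0 x = x.

Definition classNB F := locally_biholomorphic (unit_ball X) F /\ is_normalized F.

Definition convex_of_order ip alpha F :=
  locally_biholomorphic (unit_ball X) F /\
  forall z x : X, unit_ball X z -> z != 0 -> x != 0 ->
    complex.Re (ip x z) = 0 ->
    alpha * nrm x ^+ 2 <
    nrm x ^+ 2 - complex.Re (ip (inv_diff F z (second_diff F z x x)) z).

Definition classKB ip alpha F := convex_of_order ip alpha F /\ is_normalized F.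

Definition classSKB alpha F := classNB F /\
  forall z, unit_ball X z ->
    (bilin_norm (fun x y => inv_diff F z (second_diff F z x y))
      <= (1 - alpha)%:E)%E.

Definition Phi ip m (u : 'I_m -> X) (g : 'I_m -> R[i]^o -> R[i]^o) (z : X) : X :=
  z - \sum_j ip z (u j) *: u j + \sum_j g j (ip z (u j)) *: u j.

Definition hfun alpha (xi : R[i]^o) : R[i]^o :=
  if alpha == 2^-1 then - clog (1 - xi)
  else (1 - cpow (1 - xi) (2 * alpha - 1)%:C) / (2 * alpha - 1)%:C.

End Classes.

(* Main.v *)
Require Import Defs.
From HB Require Import structures.
From mathcomp Require Import all_boot all_order all_algebra.
From mathcomp Require Import complex.
From mathcomp Require Import all_classical all_reals all_analysis.
From mathcomp Require Import ring lra.
Import Order.TTheory GRing.Theory Num.Theory.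
Import numFieldNormedType.Exports.
Local Open Scope complex_scope.
Local Open Scope ring_scope.
Local Open Scope classical_set_scope.

Set Implicit Arguments.
Unset Strict Implicit.
Unset Printing Implicit Defensive.

(** Write z_j for the coordinate <z, u_j>.  In an orthonormal family completed
    by its orthogonal complement the mapping Phi acts on each coordinate z_j
    through g_j alone and fixes the complement, so its differential at z is the
    diagonal operator with entries g_j'(z_j), its second differential is
    (x, y) |-> sum_j g_j''(z_j) x_j y_j u_j, and therefore
      D Phi(z)^-1 D^2 Phi(z)(x, y) = sum_j q_j(z_j) x_j y_j u_j,
      with q_j = g_j'' / g_j'
    ([inv_diff_second_diff_Phi]).  Each of the three claims is read off from
    this formula.

    - If Phi is convex of order alpha, the test vectors z = xi u_j and
      x = i xi u_j are admissible since Re <x, z> = 0, and they turn the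
      convexity inequality into the one defining the class K(alpha) for g_j
      ([classK_of_classKB]).
    - For the extremal function, q(xi) = (2 - 2 alpha) / (1 - xi), and
      Re (xi / (1 - xi)) > -1/2 on the disk puts it in K(alpha)
      ([hfun_classK]).  Its Phi fails to be convex at z = (u_0 + u_1) / 2 in
      the direction x = u_0 - u_1, where <x, z> = 0 and the second-order term is
      too large ([hfun_not_classKB]).
    - For the bilinear norm, Bessel's inequality bounds the sum by
      max_j |q_j(z_j)|, and z = xi u_j, x = y = u_j shows that nothing smaller
      will do ([classSKU_of_classSKB], [classSKB_of_classSKU]).

    The formula requires some complex analysis, built here from estimates.
    Convergent power series are differentiated term by term, which makes an
    analytic function twice differentiable ([analytic_is_derive]); a mean value
    inequality, obtained from the real mean value theorem, upgrades this to
    strict differentiability ([is_derive_strict]).  Strict differentiability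
    passes from the g_j to Phi, and a contraction argument on the complete space
    then gives a local holomorphic inverse
    ([strict_diff_locally_biholomorphic]); conversely the chain rule makes the
    differential of a locally biholomorphic mapping injective, so that no g_j'
    vanishes.  Finally, the extremal function has to be expanded in a power
    series about every point of the disk: the logarithmic and binomial series
    are identified with clog (1 - xi) and with powers of 1 - xi because they
    solve the same first-order linear differential equations
    ([log_series], [binomial_series]). *)

(** * The real-valued norm and differentiation *)

Section RealNorm.
Context {R : realType} {X : normedModType R[i]}.
Implicit Types (x y z : X) (e d : R).

Lemma nrmE x : `|x| = (nrm x)%:C.
Proof. by rewrite /nrm RRe_real// normr_real. Qed.

Lemma nrm_ge0 x : 0 <= nrm x.
Proof. by rewrite -ler0c -nrmE. Qed.

Lemma nrm0 : nrm (0 : X) = 0.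
Proof. by rewrite /nrm normr0. Qed.

Lemma nrm_eq0 x : (nrm x == 0) = (x == 0).
Proof. by rewrite -(inj_eq (@complexI R)) -nrmE normr_eq0. Qed.

Lemma nrm_gt0 x : (0 < nrm x) = (x != 0).
Proof. by rewrite lt_def nrm_eq0 nrm_ge0 andbT. Qed.

Lemma nrmN x : nrm (- x) = nrm x.
Proof. by rewrite /nrm normrN. Qed.

Lemma nrmD x y : nrm (x + y) <= nrm x + nrm y.
Proof. by rewrite -lecR rmorphD /= -!nrmE ler_normD. Qed.

Lemma nrmB x y : nrm (x - y) <= nrm x + nrm y.
Proof. by rewrite -(nrmN y) nrmD. Qed.

Lemma nrm_sum (I : Type) (r : seq I) (P : pred I) (F : I -> X) :
  nrm (\sum_(i <- r | P i) F i) <= \sum_(i <- r | P i) nrm (F i).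
Proof.
elim/big_ind2 : _ => //; first by rewrite nrm0.
by move=> x1 x2 y1 y2 h1 h2; rewrite (le_trans (nrmD _ _))// lerD.
Qed.

Lemma nrmZ (a : R[i]^o) x : nrm (a *: x) = nrm a * nrm x.
Proof. by apply: complexI; rewrite rmorphM /= -!nrmE normrZ. Qed.

Lemma posc_ex (e : R[i]) : 0 < e -> exists2 d, 0 < d & e = d%:C.
Proof.
move=> e0; have er : e \is Num.real by rewrite gtr0_real.
by exists (complex.Re e); rewrite ?RRe_real// -ltcR RRe_real.
Qed.

Lemma nbhs_nrmP z (P : set X) :
  nbhs z P <-> exists2 d : R, 0 < d & forall x, nrm (x - z) < d -> P x.
Proof.
split=> [/nbhs_normP [e /= e0 H]|[d d0 H]].
  have [d d0 ed] := posc_ex e0; exists d => // x xz; apply: H => /=.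
  by rewrite distrC nrmE ed ltcR.
apply/nbhs_normP; exists d%:C => /=; first by rewrite ltcR.
by move=> x /=; rewrite distrC nrmE ltcR => /H.
Qed.

Lemma cvg_nrmP (T : Type) (F : set_system T) (FF : Filter F) (f : T -> X) l :
  f @ F --> l <-> forall e, 0 < e -> \forall x \near F, nrm (f x - l) <= e.
Proof.
split=> [/cvgrPdist_le H e e0|H]; last apply/cvgrPdist_le => e e0.
  have /H : 0 < e%:C by rewrite ltcR.
  by apply: filterS => x; rewrite distrC nrmE lecR.
have [d d0 ->] := posc_ex e0.
by have := H _ d0; apply: filterS => x; rewrite distrC nrmE lecR.
Qed.

End RealNorm.

Section DerivativeNorm.
Context {R : realType}.

Lemma nrm1 : nrm (1 : R[i]^o) = 1 :> R.
Proof. by rewrite /nrm normr1. Qed.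

Lemma nrmM (a b : R[i]^o) : nrm (a * b : R[i]^o) = nrm a * nrm b.
Proof. exact: nrmZ. Qed.

Lemma nrmX (a : R[i]^o) n : nrm (a ^+ n : R[i]^o) = nrm a ^+ n.
Proof. by elim: n => [|n IH]; rewrite ?nrm1// !exprS nrmM IH. Qed.

Lemma nrmV (a : R[i]^o) : nrm (a^-1 : R[i]^o) = (nrm a)^-1.
Proof.
have [->|a0] := eqVneq a 0; first by rewrite invr0 nrm0 invr0.
apply: (mulfI (_ : nrm a != 0)); first by rewrite nrm_eq0.
by rewrite -nrmM !mulfV ?nrm1// nrm_eq0.
Qed.

Lemma nrm_real (x : R) : nrm (x%:C : R[i]^o) = `|x|.
Proof. by rewrite /nrm normc_def /= expr0n /= addr0 sqrtr_sqr. Qed.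

Lemma nrm_nat n : nrm (n%:R : R[i]^o) = n%:R :> R.
Proof. by rewrite -(rmorph_nat (real_complex R)) nrm_real normr_nat. Qed.

Lemma nrm_Re (z : R[i]^o) : `|complex.Re z| <= nrm z.
Proof. by rewrite -lecR -nrmE; exact: normc_ge_Re. Qed.

Lemma nrm_sqr (z : R[i]^o) :
  nrm z ^+ 2 = complex.Re z ^+ 2 + complex.Im z ^+ 2.
Proof. by apply: complexI; rewrite rmorphXn /= -nrmE -add_Re2_Im2. Qed.

Lemma nrm_Im (z : R[i]^o) : `|complex.Im z| <= nrm z.
Proof.
rewrite -[leRHS](ger0_norm (nrm_ge0 z)) -ler_sqr ?nnegrE//.
by rewrite !real_normK ?num_real// nrm_sqr lerDr sqr_ge0.
Qed.

Lemma nrm_le_ReIm (z : R[i]^o) : nrm z <= `|complex.Re z| + `|complex.Im z|.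
Proof.
rewrite -ler_sqr ?nnegrE ?nrm_ge0 ?addr_ge0// nrm_sqr sqrrD !real_normK ?num_real//.
by rewrite addrAC lerDl mulrn_wge0// mulr_ge0.
Qed.

Context {X Y : normedModType R[i]}.

Lemma littleo_nrmP (f : X -> Y) (df : X -> Y) (z : X) :
  f \o shift z = cst (f z) + df +o_ 0 id <->
  forall e : R, 0 < e -> \forall h \near (0 : X),
    nrm (f (z + h) - f z - df h) <= e * nrm h.
Proof.
split=> [/eqaddoP H e e0|H]; last apply/eqaddoP => e e0.
  have /H : 0 < e%:C by rewrite ltcR.
  by apply: filterS => h /=; rewrite !nrmE -rmorphM lecR !fctE [h + z]addrC opprD addrA.
have [d d0 ->] := posc_ex e0.
have := H _ d0; apply: filterS => h /=; rewrite !nrmE -rmorphM lecR !fctE /=.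
by rewrite [h + z]addrC opprD addrA.
Qed.

(** The bound makes [df] continuous, and the estimate is the little-o
    expansion that determines the differential. *)
Lemma diff_nrm (f : X -> Y) (df : X -> Y) (z : X) :
  linear df -> (exists M : R, forall h, nrm (df h) <= M * nrm h) ->
  (forall e : R, 0 < e -> \forall h \near (0 : X),
    nrm (f (z + h) - f z - df h) <= e * nrm h) ->
  differentiable f z /\ forall h, 'd f z h = df h.
Proof.
move=> ldf [M bM] /littleo_nrmP H.
pose Ld := GRing.isLinear.Build _ _ _ _ _ ldf.
pose L : {linear X -> Y} := HB.pack df Ld.
have cL : continuous L.
  apply/linear_bounded_continuous/bounded_funP => r.
  exists (`|M|%:C * `|r|) => x xr; rewrite nrmE.
  have xr' : `|x| <= `|r|.
    by rewrite (le_trans xr)// real_ler_norm// ger0_real// (le_trans _ xr).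
  apply: le_trans (ler_wpM2l _ xr'); last by rewrite ler0c.
  by rewrite nrmE -rmorphM lecR (le_trans (bM x))// ler_wpM2r ?nrm_ge0// ler_norm.
have dE : 'd f z = L :> (X -> Y) by apply: diff_unique.
split; last by move=> h; rewrite dE.
by apply/diff_locallyP; rewrite dE.
Qed.

Lemma diff_scale (f : X -> Y) (z : X) k h : 'd f z (k *: h) = k *: 'd f z h.
Proof. by rewrite linearZ. Qed.

Lemma diff_nrmP (f : X -> Y) (z : X) : differentiable f z ->
  forall e : R, 0 < e -> \forall h \near (0 : X),
    nrm (f (z + h) - f z - 'd f z h) <= e * nrm h.
Proof. by move=> /diff_locallyP [_] /littleo_nrmP. Qed.

End DerivativeNorm.

Section ComplexDerivative.
Context {R : realType}.
Local Notation C := R[i]^o.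
Implicit Types (f g : C -> C) (z a : C).

Lemma is_derive_nrm f z a :
  (forall e : R, 0 < e -> \forall h \near (0 : C),
    nrm (f (z + h) - f z - h * a : C) <= e * nrm h) ->
  is_derive z 1 f a.
Proof.
move=> H.
have lin : linear (fun h : C => h * a : C).
  by move=> k x y; rewrite mulrDl scalerAl.
have [df dE] : differentiable f z /\ forall h : C, 'd f z h = h * a.
  apply: diff_nrm => //.
  by exists (nrm a) => h; rewrite nrmM mulrC.
split; first exact/derivable1_diffP.
by rewrite deriveE// dE mul1r.
Qed.

Lemma is_derive_diff f z a : is_derive z 1 f a ->
  differentiable f z /\ forall h : C, 'd f z h = h * a.
Proof.
move=> [df <-]; have df' : differentiable f z by exact/derivable1_diffP.
split=> // h; rewrite deriveE//.
have E : h = h *: (1 : C) by rewrite -[RHS]/(h * 1) mulr1.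
by rewrite [in LHS]E; exact: diff_scale.
Qed.

Lemma is_derive_nrmP f z a : is_derive z 1 f a ->
  forall e : R, 0 < e -> \forall h \near (0 : C),
    nrm (f (z + h) - f z - h * a : C) <= e * nrm h.
Proof.
move=> /is_derive_diff[df dE] e e0; have := diff_nrmP df e0.
by apply: filterS => h; rewrite dE.
Qed.

Lemma is_derive_comp f g z a b : is_derive z 1 g b -> is_derive (g z) 1 f a ->
  is_derive z 1 (f \o g) (a * b).
Proof.
move=> /is_derive_diff[dg gE] /is_derive_diff[df fE].
have dfg : differentiable (f \o g) z.
  exact: (@differentiable_comp _ C C C g f z dg df).
split; first exact/derivable1_diffP.
have E : 'd (f \o g) z = 'd f (g z) \o 'd g z :> (C -> C).
  exact: (@diff_comp _ C C C g f z dg df).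
rewrite (deriveE _ dfg).
rewrite E.
by rewrite /= fE gE mul1r mulrC.
Qed.

Lemma derive1_val f z a : is_derive z 1 f a -> derive1 f z = a.
Proof. by move=> [_ <-]; rewrite derive1E. Qed.

End ComplexDerivative.

(** * Power series over the complex numbers *)

Lemma cvg_succ (K : numFieldType) (V : normedModType K) (u : nat -> V) (l : V) :
  u @ \oo --> l -> (fun n => u n.+1) @ \oo --> l.
Proof. by rewrite -(cvg_shiftS u). Qed.

Section PowerSeries.
Context {R : realType}.
Local Notation C := R[i]^o.
Implicit Types (c u : nat -> C) (z w h l : C).

Lemma cvgC_ReIm (u : nat -> C) (a b : R) :
  (fun n => complex.Re (u n)) @ \oo --> a ->
  (fun n => complex.Im (u n)) @ \oo --> b ->
  u @ \oo --> (a +i* b : C).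
Proof.
move=> /cvgrPdist_le ua /cvgrPdist_le ub; apply/cvg_nrmP => e e0.
have e2 : 0 < e / 2 by rewrite divr_gt0.
have := ua _ e2; have := ub _ e2; apply: filterS2 => n hb ha.
rewrite (le_trans (nrm_le_ReIm _))// [leRHS]splitr.
move: ha hb; case: (u n) => x y /= ha hb.
by rewrite lerD// distrC.
Qed.

Lemma Re_series u n :
  complex.Re (series u n) = series (fun k => complex.Re (u k)) n.
Proof.
elim: n => [|n IH]; first by rewrite /series /= !big_geq.
by rewrite !seriesSr -IH; case: (u n); case: (series u n).
Qed.

Lemma Im_series u n :
  complex.Im (series u n) = series (fun k => complex.Im (u k)) n.
Proof.
elim: n => [|n IH]; first by rewrite /series /= !big_geq.
by rewrite !seriesSr -IH; case: (u n); case: (series u n).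
Qed.

Lemma series_geometric_le (q M : R) n : 0 <= q < 1 -> 0 <= M ->
  \sum_(0 <= k < n) M * q ^+ k <= M / (1 - q).
Proof.
move=> /andP[q0 q1] M0.
have := @geometric_seriesE R M q (negbT (lt_eqF q1)).
move=> /(congr1 (fun f => f n)); rewrite /series /= => ->.
rewrite -!mulrA ler_wpM2l// ler_pdivrMr ?subr_gt0// mulVf ?gt_eqF ?subr_gt0//.
by rewrite gerBl exprn_ge0.
Qed.

(** Completeness enters through the real and imaginary parts, which are
    dominated by a convergent geometric series. *)
Lemma cvgC_series_geometric u (q M : R) : 0 <= q < 1 ->
  (forall n, nrm (u n) <= M * q ^+ n) -> exists l, series u @ \oo --> l.
Proof.
move=> /andP[q0 q1] uM.
have M0 : 0 <= M by have := uM 0%N; rewrite mulr1; apply: le_trans; exact: nrm_ge0.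
have real_cvg (v : nat -> R) : (forall n, `|v n| <= nrm (u n)) -> cvgn (series v).
  move=> vu; apply: normed_cvg.
  apply: (@series_le_cvg _ _ (geometric M q)) => [n|n|n|] //=.
  - by rewrite mulr_ge0 ?exprn_ge0.
  - exact: le_trans (vu n) (uM n).
  - by apply: is_cvg_geometric_series; rewrite ger0_norm.
have /cvg_ex[/= a ha] := real_cvg (fun k => complex.Re (u k)) (fun k => nrm_Re _).
have /cvg_ex[/= b hb] := real_cvg (fun k => complex.Im (u k)) (fun k => nrm_Im _).
exists (a +i* b : C); apply: cvgC_ReIm.
  by under eq_fun do rewrite Re_series.
by under eq_fun do rewrite Im_series.
Qed.

Lemma cvg_nrm_le u l (K : R) :
  u @ \oo --> l -> (forall n, nrm (u n) <= K) -> nrm l <= K.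
Proof.
move=> /cvg_nrmP ul uK; apply/ler_addgt0Pr => e e0.
have [N _ /(_ N (leqnn N)) /= H] := ul e e0.
have -> : l = u N - (u N - l) by rewrite opprB addrC subrK.
by rewrite (le_trans (nrmB _ _))// lerD.
Qed.

Lemma pseries_coef_bound c z (l : C) :
  series (fun n => c n * z ^+ n) @ \oo --> l ->
  exists2 M : R, 0 <= M & forall n, nrm (c n) * nrm z ^+ n <= M.
Proof.
move=> cl; have : cvgn (series (fun n => c n * z ^+ n)) by apply/cvg_ex; exists l.
move=> /cvg_series_cvg_0 /cvg_nrmP /(_ 1 ltr01) [N _ H].
exists (1 + \sum_(k < N) nrm (c k) * nrm z ^+ k) => [|n].
  by rewrite addr_ge0// sumr_ge0// => k _; rewrite mulr_ge0 ?exprn_ge0 ?nrm_ge0.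
have T0 k : 0 <= nrm (c k) * nrm z ^+ k by rewrite mulr_ge0 ?exprn_ge0 ?nrm_ge0.
have [nN|Nn] := ltnP n N.
  by rewrite (bigD1 (Ordinal nN))//= addrCA lerDl addr_ge0// sumr_ge0.
have := H n Nn; rewrite /= subr0 nrmM nrmX => /le_trans; apply.
by rewrite lerDl sumr_ge0.
Qed.

(** The remainder satisfies r (n + 1) = (x + d) r n + n d^2 x^(n - 1); its
    positivity yields the bound n d x^(n - 1) <= (x + d)^n used to sum derived
    series. *)
Lemma expr_taylor1_ge0 (x d : R) n : 0 <= x -> 0 <= d ->
  0 <= (x + d) ^+ n - x ^+ n - n%:R * d * x ^+ n.-1.
Proof.
move=> x0 d0; elim: n => [|n IH]; first by rewrite !expr0 !mul0r subr0 subrr.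
have -> : (x + d) ^+ n.+1 - x ^+ n.+1 - n.+1%:R * d * x ^+ n.+1.-1 =
  (x + d) * ((x + d) ^+ n - x ^+ n - n%:R * d * x ^+ n.-1)
    + n%:R * d ^+ 2 * x ^+ n.-1.
  case: n {IH} => [|n] /=; first by rewrite expr1 expr0; ring.
  by rewrite !exprS -!natr1; ring.
apply: addr_ge0; first by rewrite mulr_ge0// addr_ge0.
by rewrite mulr_ge0 ?exprn_ge0// mulr_ge0 ?exprn_ge0.
Qed.

(** The complex remainder and the real one at (|w|, d) obey the same
    recursion, so one dominates the other.  The right-hand side is at most
    |h|^2 (|w| + d)^n: the factor n^2 of the usual second-order estimate is
    traded for a slightly larger radius, which geometric decay absorbs. *)
Lemma expr_taylor1_le w h (d : R) n : nrm h <= d ->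
  nrm ((w + h) ^+ n - w ^+ n - n%:R * h * w ^+ n.-1 : C) * d ^+ 2
    <= nrm h ^+ 2 * ((nrm w + d) ^+ n - nrm w ^+ n - n%:R * d * nrm w ^+ n.-1).
Proof.
move=> hd; have d0 : 0 <= d := le_trans (nrm_ge0 h) hd.
elim: n => [|n IH].
  by rewrite !expr0 !mul0r subrr subr0 nrm0 mul0r subr0 subrr mulr0.
have -> : (w + h) ^+ n.+1 - w ^+ n.+1 - n.+1%:R * h * w ^+ n.+1.-1 =
  (w + h) * ((w + h) ^+ n - w ^+ n - n%:R * h * w ^+ n.-1)
    + n%:R * h ^+ 2 * w ^+ n.-1.
  case: n {IH} => [|n] /=; first by rewrite expr1 expr0; ring.
  by rewrite !exprS -!natr1; ring.
have -> : (nrm w + d) ^+ n.+1 - nrm w ^+ n.+1 - n.+1%:R * d * nrm w ^+ n.+1.-1 =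
  (nrm w + d) * ((nrm w + d) ^+ n - nrm w ^+ n - n%:R * d * nrm w ^+ n.-1)
    + n%:R * d ^+ 2 * nrm w ^+ n.-1.
  case: n {IH} => [|n] /=; first by rewrite expr1 expr0; ring.
  by rewrite !exprS -!natr1; ring.
rewrite [leRHS]mulrDr [X in _ <= X + _]mulrCA.
have -> : nrm h ^+ 2 * (n%:R * d ^+ 2 * nrm w ^+ n.-1) =
   nrm (n%:R * h ^+ 2 * w ^+ n.-1 : C) * d ^+ 2.
  by rewrite !nrmM !nrmX nrm_nat; ring.
apply: le_trans (lerD (ler_wpM2l _ IH) (lexx _)); last by rewrite addr_ge0// nrm_ge0.
rewrite [X in _ <= X + _]mulrA -[leRHS]mulrDl ler_wpM2r ?sqr_ge0//.
rewrite (le_trans (nrmD _ _))// lerD2r.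
by rewrite nrmM ler_wpM2r ?nrm_ge0// (le_trans (nrmD _ _))// lerD2l.
Qed.


Lemma pseries_deriv_cvg c z (d s M : R) : 0 < d -> nrm z + d < s ->
  (forall n, nrm (c n) * s ^+ n <= M) ->
  exists l : C, series (fun n => n.+1%:R * c n.+1 * z ^+ n) @ \oo --> l.
Proof.
move=> d0 ps cM; set p := nrm z + d in ps.
have p0 : 0 <= p by rewrite addr_ge0 ?nrm_ge0 ?ltW.
have s0 : 0 < s := le_lt_trans p0 ps.
apply: (@cvgC_series_geometric _ (p / s) (M / d * (p / s))) => [|n].
  by rewrite divr_ge0 ?(ltW s0)//= ltr_pdivrMr// mul1r.
rewrite !nrmM nrm_nat nrmX -[leRHS]mulrA -exprS exprMn exprVn.
have h1 : n.+1%:R * d * nrm z ^+ n <= p ^+ n.+1.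
  have := expr_taylor1_ge0 n.+1 (nrm_ge0 z) (ltW d0); rewrite subr_ge0 => /le_trans.
  by apply; rewrite gerBl exprn_ge0// nrm_ge0.
have sn0 : 0 < s ^+ n.+1 by rewrite exprn_gt0.
have -> : n.+1%:R * nrm (c n.+1) * nrm z ^+ n =
  (nrm (c n.+1) * s ^+ n.+1) * (n.+1%:R * d * nrm z ^+ n) / (d * s ^+ n.+1).
  by field; rewrite gt_eqF//= gt_eqF.
have -> : M / d * (p ^+ n.+1 / s ^+ n.+1) = M * p ^+ n.+1 / (d * s ^+ n.+1).
  by rewrite invfM; ring.
rewrite ler_wpM2r ?invr_ge0 ?mulr_ge0 ?(ltW d0) ?(ltW sn0)//.
apply: ler_pM => //; first by rewrite mulr_ge0 ?nrm_ge0 ?ltW.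
by rewrite mulr_ge0 ?exprn_ge0 ?nrm_ge0// mulr_ge0// ltW.
Qed.

Lemma pseries_diff_quotient c z h N :
  series (fun n => c n * (z + h) ^+ n) N.+1 - series (fun n => c n * z ^+ n) N.+1
    - h * series (fun n => n.+1%:R * c n.+1 * z ^+ n) N =
  series (fun n => c n * ((z + h) ^+ n - z ^+ n - n%:R * h * z ^+ n.-1)) N.+1.
Proof.
elim: N => [|N IH].
  rewrite !seriesSr /series /= !big_geq// !expr0; ring.
rewrite [in RHS]seriesSr -IH.
rewrite [series (fun n => c n * (z + h) ^+ n) N.+2]seriesSr.
rewrite [series (fun n => c n * z ^+ n) N.+2]seriesSr.
rewrite [series (fun n => n.+1%:R * c n.+1 * z ^+ n) N.+1]seriesSr /=.
ring.
Qed.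

Lemma pseries_taylor1_bound c z h (d s M : R) N : 0 < d -> nrm z + d < s ->
  nrm h <= d -> (forall n, nrm (c n) * s ^+ n <= M) ->
  nrm (series (fun n => c n * ((z + h) ^+ n - z ^+ n - n%:R * h * z ^+ n.-1)) N : C)
    <= M / (1 - (nrm z + d) / s) / d ^+ 2 * nrm h ^+ 2.
Proof.
move=> d0 ps hd cM; set p := nrm z + d in ps *.
have p0 : 0 <= p by rewrite addr_ge0 ?nrm_ge0 ?ltW.
have s0 : 0 < s := le_lt_trans p0 ps.
have M0 : 0 <= M.
  by apply: le_trans (cM 0%N); rewrite mulr_ge0 ?nrm_ge0// exprn_ge0// ltW.
have q01 : 0 <= p / s < 1.
  by rewrite divr_ge0 ?(ltW s0)//= ltr_pdivrMr// mul1r.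
rewrite (le_trans (nrm_sum _ _ _))//.
have -> : M / (1 - p / s) / d ^+ 2 * nrm h ^+ 2
  = nrm h ^+ 2 / d ^+ 2 * (M / (1 - p / s)) by ring.
apply: le_trans (ler_wpM2l _ (series_geometric_le N q01 M0)); last first.
  by rewrite divr_ge0 ?sqr_ge0.
rewrite mulr_sumr; apply: ler_sum => n _; rewrite nrmM.
have hT := expr_taylor1_le z n hd.
set T := nrm (_ - _ - _) in hT *.
have T0 : 0 <= T by exact: nrm_ge0.
have {}hT : T * d ^+ 2 <= nrm h ^+ 2 * p ^+ n.
  rewrite (le_trans hT)// ler_wpM2l ?sqr_ge0// -addrA -opprD gerBl.
  by rewrite addr_ge0 ?mulr_ge0 ?exprn_ge0 ?nrm_ge0 ?(ltW d0).
have sn0 : 0 < s ^+ n by rewrite exprn_gt0.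
have -> : nrm (c n) * T = (nrm (c n) * s ^+ n) * (T * d ^+ 2) / (s ^+ n * d ^+ 2).
  by field; rewrite (gt_eqF d0)/= gt_eqF.
have -> : nrm h ^+ 2 / d ^+ 2 * (M * (p / s) ^+ n) =
  M * (nrm h ^+ 2 * p ^+ n) / (s ^+ n * d ^+ 2).
  by rewrite expr_div_n; field; rewrite (gt_eqF d0)/= gt_eqF.
have D0 : 0 < s ^+ n * d ^+ 2 by rewrite mulr_gt0 ?exprn_gt0.
rewrite ler_wpM2r ?invr_ge0 ?(ltW D0)//.
apply: ler_pM => //; first by rewrite mulr_ge0 ?nrm_ge0 ?ltW.
by rewrite mulr_ge0// sqr_ge0.
Qed.

(** The first-order Taylor remainders of the partial sums are bounded by
    K |h|^2 with K independent of the number of terms, so the bound survives the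
    limit. *)
Lemma pseries_derive c (F : C -> C) z0 (r : R) :
  (forall z, nrm (z - z0) < r ->
    series (fun n => c n * (z - z0) ^+ n) @ \oo --> F z) ->
  exists G : C -> C, forall z, nrm (z - z0) < r ->
    series (fun n => n.+1%:R * c n.+1 * (z - z0) ^+ n) @ \oo --> G z /\
    is_derive z 1 F (G z).
Proof.
move=> cF.
pose P z l := nrm (z - z0) < r ->
  series (fun n => n.+1%:R * c n.+1 * (z - z0) ^+ n) @ \oo --> l /\
    is_derive z 1 F l.
suff /choice[G GP] : forall z, exists l, P z l by exists G => z zr; exact: GP.
move=> z; have [zr|zr] := boolP (nrm (z - z0) < r); last first.
  by exists 0; rewrite /P (negPf zr).
set w := z - z0 in zr *.
(* |w| < |w| + d < s < r: [d] bounds the increments and the coefficients are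
   controlled at radius [s]. *)
pose d := (r - nrm w) / 3; pose s := nrm w + 2 * d.
have d0 : 0 < d by rewrite divr_gt0// subr_gt0.
have ps : nrm w + d < s by rewrite /s; lra.
have sr : s < r by rewrite /s /d; lra.
have s0 : 0 <= s by rewrite addr_ge0 ?nrm_ge0// mulr_ge0// ltW.
have [M M0 cM] : exists2 M : R, 0 <= M & forall n, nrm (c n) * s ^+ n <= M.
  have zs : nrm (z0 + s%:C - z0 : C) = s by rewrite addrC addKr nrm_real ger0_norm.
  have := cF (z0 + s%:C); rewrite zs => /(_ sr) /pseries_coef_bound.
  by rewrite zs.
have [l cl] := pseries_deriv_cvg d0 ps cM.
exists l => _; split; first exact: cl.
set K := M / (1 - (nrm w + d) / s) / d ^+ 2.
have K0 : 0 <= K.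
  rewrite divr_ge0 ?sqr_ge0// divr_ge0// subr_ge0 ler_pdivrMr ?mul1r ?ltW//.
  by rewrite (le_lt_trans _ ps)// addr_ge0 ?nrm_ge0// ltW.
have key h : nrm h <= d -> nrm (F (z + h) - F z - h * l : C) <= K * nrm h ^+ 2.
  move=> hd.
  have zhr : nrm (z + h - z0) < r.
    by rewrite addrAC (le_lt_trans (nrmD _ _))// -/w (le_lt_trans _ sr)// /s; lra.
  have c1 := cF _ zhr; have c2 := cF _ zr.
  rewrite addrAC -/w in c1; rewrite -/w in c2.
  pose S1 := series (fun n => c n * (w + h) ^+ n).
  pose S2 := series (fun n => c n * w ^+ n).
  have c1' : (fun n => S1 n.+1) @ \oo --> F (z + h).
    exact: cvg_succ c1.
  have c2' : (fun n => S2 n.+1) @ \oo --> F z by exact: cvg_succ c2.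
  apply: cvg_nrm_le.
    exact: (cvgB (cvgB c1' c2') (cvgM (cvg_cst h) cl)).
  move=> N; have := pseries_taylor1_bound N.+1 d0 ps hd cM.
  by rewrite -pseries_diff_quotient; apply.
apply: is_derive_nrm => e e0.
have m0 : 0 < Num.min d (e / (K + 1)).
  by rewrite lt_min d0 divr_gt0// ltr_wpDl.
apply/nbhs_nrmP; exists (Num.min d (e / (K + 1))) => // h.
rewrite subr0 lt_min => /andP[hd he].
rewrite (le_trans (key _ (ltW hd)))// expr2 mulrA ler_wpM2r ?nrm_ge0//.
move: he; rewrite ltr_pdivlMr ?ltr_wpDl// => he.
by have := nrm_ge0 h; nra.
Qed.

End PowerSeries.

(** * Mean value inequality and analytic functions *)

Lemma is_derive_real (R : realType) (f : R -> R) (t a : R) :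
  (forall e : R, 0 < e -> \forall h \near (0 : R),
    `|f (t + h) - f t - h * a| <= e * `|h|) ->
  is_derive t 1 f a.
Proof.
move=> H.
have Q : (fun h : R => h^-1 *: ((f \o shift t) (h *: 1) - f t)) @ 0^' --> a.
  apply/cvgrPdist_le => e e0.
  have := H e e0; rewrite /dnbhs /within /=; apply: filterS => h Hd h0.
  rewrite distrC [h *: 1]mulr1 [h + t]addrC.
  have -> : h^-1 *: (f (t + h) - f t) - a = h^-1 * (f (t + h) - f t - h * a).
    by rewrite /= mulrBr mulKf.
  by rewrite normrM normfV ler_pdivrMl ?normr_gt0// [leRHS]mulrC.
by split; [apply/cvg_ex; exists a|exact: cvg_lim Q].
Qed.

Section AnalyticFunctions.
Context {R : realType}.
Local Notation C := R[i]^o.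
Implicit Types (f : C -> C) (z : C).

(** Near [z] the derivative is again the sum of a power series, so the
    termwise rule applies a second time. *)
Lemma analytic_is_derive (A : set C) f z : open A -> analytic_on A f -> A z ->
  is_derive z 1 f (derive1 f z) /\
  is_derive z 1 (derive1 f) (derive1n 2 f z).
Proof.
move=> oA fA Az; have [c [r [r0 cf]]] := fA z Az.
have cf' w : nrm (w - z) < r -> series (fun n => c n * (w - z) ^+ n) @ \oo --> f w.
  by move=> wr; apply: cf; rewrite nrmE ltcR.
have [G GP] := pseries_derive cf'.
have [H HP] := pseries_derive (fun w wr => (GP w wr).1).
have zr : nrm (z - z) < r by rewrite subrr nrm0.
have dG : \near z, G z = derive1 f z.
  apply/nbhs_nrmP; exists r => // w wr.
  by rewrite (derive1_val (GP w wr).2).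
have d1 := (GP z zr).2; have d2 := near_eq_is_derive dG (HP z zr).2.
split; first by rewrite (derive1_val d1).
by rewrite /derive1n /= (derive1_val d2).
Qed.

Lemma Re_conj_mul (a b : C) :
  complex.Re (a^* * b) = complex.Re a * complex.Re b + complex.Im a * complex.Im b.
Proof. by case: a b => [a1 a2] [b1 b2] /=; rewrite mulNr opprK. Qed.

(** With v = f b - f a, the real function t |-> Re (conj v * f (a + t (b - a)))
    increases by |v|^2 over [0, 1]; the real mean value theorem bounds that
    increase by |v| K |b - a|. *)
Lemma mean_value_inequality (f f1 : C -> C) (a b : C) (K : R) :
  (forall t : R, 0 <= t <= 1 ->
     is_derive (a + t%:C * (b - a)) 1 f (f1 (a + t%:C * (b - a)))) ->
  (forall t : R, 0 <= t <= 1 -> nrm (f1 (a + t%:C * (b - a))) <= K) ->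
  nrm (f b - f a) <= K * nrm (b - a).
Proof.
move=> df bf; set v := f b - f a.
pose p (t : R) : C := a + t%:C * (b - a).
pose phi t := complex.Re (v^* * f (p t)).
pose dphi t := complex.Re (v^* * (f1 (p t) * (b - a))).
have dphiP (t : R) : 0 <= t <= 1 -> is_derive t 1 phi (dphi t).
  move=> t01; apply: is_derive_real => e e0.
  (* the increment h (b - a) is paired with v, and 1 keeps [k] positive *)
  pose k := nrm v * nrm (b - a) + 1.
  have k0 : 0 < k by rewrite ltr_wpDl// mulr_ge0 ?nrm_ge0.
  have ek : 0 < e / k by rewrite divr_gt0.
  have /nbhs_nrmP[d d0 Hd] := is_derive_nrmP (df t t01) ek.
  have dk : 0 < d / (nrm (b - a) + 1) by rewrite divr_gt0// ltr_wpDl ?nrm_ge0.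
  apply/nbhs_normP; exists (d / (nrm (b - a) + 1)) => //= h /=.
  rewrite sub0r normrN ltr_pdivlMr ?ltr_wpDl ?nrm_ge0// => hd.
  have nh : nrm (h%:C * (b - a) : C) = `|h| * nrm (b - a) by rewrite nrmM nrm_real.
  have := Hd (h%:C * (b - a)); rewrite subr0 nh => Hh.
  have : `|h| * nrm (b - a) < d.
    by apply: le_lt_trans hd; rewrite ler_wpM2l// lerDl.
  move=> /Hh {Hh}Hd'.
  have E : p t + h%:C * (b - a) = p (t + h) by rewrite /p rmorphD mulrDl addrA.
  rewrite -/(p t) E in Hd'.
  have -> : phi (t + h) - phi t - h * dphi t =
    complex.Re (v^* * (f (p (t + h)) - f (p t) - h%:C * (b - a) * f1 (p t))).
    rewrite /phi /dphi.
    move: (f (p (t + h))) (f (p t)) (f1 (p t)) (b - a) v^*.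
    by move=> [? ?] [? ?] [? ?] [? ?] [? ?] /=; ring.
  rewrite (le_trans (nrm_Re _))// nrmM.
  have -> : nrm (v^* : C) = nrm v by rewrite /nrm normcJ.
  rewrite (le_trans (ler_wpM2l (nrm_ge0 _) Hd'))//.
  rewrite mulrA [_ * (e / k)]mulrC -!mulrA ler_wpM2l ?(ltW e0)//.
  rewrite ler_pdivrMl// mulrCA [leRHS]mulrC ler_wpM2l//.
  by rewrite /k lerDl.
have cphi : {within `[0, 1], continuous phi}.
  apply: derivable_within_continuous => t; rewrite in_itv /= => t01.
  by have [] := dphiP t t01.
have [t] : exists2 t : R, t \in `[0, 1]%R & phi 1 - phi 0 = dphi t * (1 - 0).
  apply: (@MVT_segment R phi dphi 0 1 ler01 _ cphi) => t.
  rewrite in_itv /= => /andP[t0 t1].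
  by apply: dphiP; rewrite !ltW.
rewrite in_itv /= subr0 mulr1 => t01 E.
have vv : nrm v ^+ 2 <= nrm v * (K * nrm (b - a)).
  have -> : nrm v ^+ 2 = phi 1 - phi 0.
    rewrite /phi /p rmorph1 mul1r rmorph0 mul0r addr0 [a + _]addrC subrK.
    rewrite nrm_sqr !Re_conj_mul /v; case: (f b) (f a) => [? ?] [? ?] /=; ring.
  rewrite E /dphi (le_trans (ler_norm _))// (le_trans (nrm_Re _))// !nrmM.
  have -> : nrm (v^* : C) = nrm v by rewrite /nrm normcJ.
  by rewrite ler_wpM2l ?nrm_ge0// ler_wpM2r ?nrm_ge0// bf.
have [v0|v0] := eqVneq (nrm v) 0.
  have K0 : 0 <= K by apply: le_trans (bf 0 _); rewrite ?nrm_ge0 ?lexx ?ler01.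
  by rewrite v0 mulr_ge0// nrm_ge0.
by move: vv; rewrite expr2 ler_pM2l// lt_def v0 nrm_ge0.
Qed.

Lemma is_derive0_eq (f : C -> C) (z0 : C) (r : R) :
  (forall z, nrm (z - z0) < r -> is_derive z 1 f 0) ->
  forall z, nrm (z - z0) < r -> f z = f z0.
Proof.
move=> df z zr.
suff : nrm (f z - f z0) <= 0 * nrm (z - z0).
  rewrite mul0r le_eqVlt nrm_eq0 subr_eq0 ltNge nrm_ge0 orbF.
  by move/eqP.
apply: (@mean_value_inequality f (fun=> 0) z0 z 0) => t /andP[t0 t1];
  last by rewrite nrm0.
apply: df; rewrite addrC addKr nrmM nrm_real ger0_norm//.
by rewrite (le_lt_trans _ zr)// ler_piMl// nrm_ge0.
Qed.

(** Since the derivative is continuous at [z0], the function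
    f z - z f'(z0) has derivative at most e near [z0], and the mean value
    inequality applies to it. *)
Lemma is_derive_strict f z0 (D : R) : 0 < D ->
  (forall z, nrm (z - z0) < D -> is_derive z 1 f (derive1 f z)) ->
  is_derive z0 1 (derive1 f) (derive1n 2 f z0) ->
  forall e : R, 0 < e -> exists2 d : R, 0 < d & forall x y : C,
    nrm (x - z0) < d -> nrm (y - z0) < d ->
    nrm (f x - f y - derive1 f z0 * (x - y)) <= e * nrm (x - y).
Proof.
move=> D0 df d2f e e0; set a := derive1 f z0.
have [d2 _] := is_derive_diff d2f.
have /differentiable_continuous/cvg_nrmP /(_ e e0) /nbhs_nrmP[d d0 Hd] := d2.
exists (Num.min d D) => [|x y]; first by rewrite lt_min d0.
rewrite !lt_min => /andP[xd xD] /andP[yd yD].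
pose g z := f z - z * a.
have -> : f x - f y - a * (x - y) = g x - g y by rewrite /g; ring.
have seg (r t : R) : 0 <= t <= 1 -> nrm (x - z0) < r -> nrm (y - z0) < r ->
   nrm (y + t%:C * (x - y) - z0) < r.
  move=> /andP[t0 t1] xr yr.
  have -> : y + t%:C * (x - y) - z0 = (1 - t)%:C * (y - z0) + t%:C * (x - z0).
    by rewrite rmorphB rmorph1 /=; ring.
  rewrite (le_lt_trans (nrmD _ _))// !nrmM !nrm_real !ger0_norm ?subr_ge0//.
  have [->|tn] := eqVneq t 0; first by rewrite subr0 mul1r mul0r addr0.
  have t0' : 0 < t by rewrite lt_def tn.
  have -> : r = (1 - t) * r + t * r by ring.
  by rewrite ler_ltD ?ltr_pM2l// ler_wpM2l ?subr_ge0// ltW.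
have bg (t : R) : 0 <= t <= 1 ->
    nrm (derive1 f (y + t%:C * (x - y)) - a : C) <= e.
  by move=> t01; exact: (Hd _ (seg d t t01 xd yd)).
have dg (t : R) : 0 <= t <= 1 -> is_derive (y + t%:C * (x - y) : C) 1 g
    (derive1 f (y + t%:C * (x - y)) - a).
  move=> t01; have H1 := df _ (seg D t t01 xD yD).
  set w := (_ + _ : C) in H1 *.
  apply: is_derive_nrm => e' e0'.
  have := is_derive_nrmP H1 e0'; apply: filterS => h.
  have -> // : g (w + h) - g w - h * (derive1 f w - a) =
    f (w + h) - f w - h * derive1 f w by rewrite /g; ring.
exact: (@mean_value_inequality g (fun z => derive1 f z - a) y x e dg bg).
Qed.

End AnalyticFunctions.

(** * Complex exponential and logarithm *)

Section DerivativeRules.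
Context {R : realType}.
Local Notation C := R[i]^o.
Implicit Types (f g : C -> C) (z a b k : C).

Lemma is_derive_cmul f g z a b : is_derive z 1 f a -> is_derive z 1 g b ->
  is_derive z 1 (fun w => f w * g w) (a * g z + f z * b).
Proof.
move=> df dg; have := @is_deriveM _ C f g z 1 a b df dg.
have -> : f z *: b + g z *: a = a * g z + f z * b; last exact.
by rewrite addrC; congr (_ + _); exact: mulrC.
Qed.

Lemma is_derive_cadd f g z a b : is_derive z 1 f a -> is_derive z 1 g b ->
  is_derive z 1 (fun w => f w + g w) (a + b).
Proof. by move=> df dg; exact: (@is_deriveD _ C C f g z 1 a b df dg). Qed.

Lemma is_derive_ccst k z : is_derive z 1 (fun=> k) 0.
Proof. exact: (@is_derive_cst _ C C k z 1). Qed.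

Lemma is_derive_cid z : is_derive z 1 (fun w => w) 1.
Proof. exact: (@is_derive_id _ C z 1). Qed.

Lemma is_derive_cscale f k z a : is_derive z 1 f a ->
  is_derive z 1 (fun w => k * f w) (k * a).
Proof.
move=> df; have := is_derive_cmul (is_derive_ccst k z) df.
by rewrite mul0r add0r.
Qed.

Lemma is_derive_ceq f g z a b : is_derive z 1 f a -> f =1 g -> a = b ->
  is_derive z 1 g b.
Proof. by move=> df /funext <- <-. Qed.

Lemma is_derive_caffine k b z : is_derive z 1 (fun w => k * w + b) k.
Proof.
have := is_derive_cadd (is_derive_cscale k (is_derive_cid z)) (is_derive_ccst b z).
by rewrite mulr1 addr0.
Qed.

End DerivativeRules.

Section ComplexExponential.
Context {R : realType}.
Local Notation C := R[i]^o.
Implicit Types (z a b : C).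

Lemma cexpD (a b : C) : cexp (a + b) = cexp a * cexp b.
Proof.
case: a b => [x y] [x' y']; rewrite /cexp /= expRD cosD sinD.
by apply/eqP; rewrite eq_complex /=; apply/andP; split; apply/eqP; ring.
Qed.

Lemma cexp0 : cexp (0 : C) = 1.
Proof. by rewrite /cexp /= expR0 cos0 sin0 mul1r. Qed.

Lemma cexpN_mul z : cexp (- z) * cexp z = 1.
Proof. by rewrite -cexpD addNr cexp0. Qed.

Lemma cexp_neq0 z : cexp z != 0.
Proof.
apply/eqP => z0; have := cexpN_mul z; rewrite z0 mulr0 => /esym/eqP.
by rewrite oner_eq0.
Qed.

Lemma cexpN z : cexp (- z) = (cexp z)^-1.
Proof.
apply: (mulIf (cexp_neq0 z)); rewrite cexpN_mul mulVf//; exact: cexp_neq0.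
Qed.

Lemma near0_ball (P : R -> Prop) : (\forall h \near (0 : R), P h) ->
  exists2 r : R, 0 < r & forall h, `|h| < r -> P h.
Proof.
move=> /nbhs_normP[r /= r0 H]; exists r => // h hr; apply: H.
by rewrite /ball_ /= sub0r normrN.
Qed.

Lemma is_derive_real_near (f : R -> R) (t a : R) : is_derive t 1 f a ->
  forall e : R, 0 < e -> \forall h \near (0 : R),
    `|f (t + h) - f t - h * a| <= e * `|h|.
Proof.
move=> [df <-] e e0; have := derivable_nbhs df => /eqaddoP /(_ e e0).
apply: filterS => h; rewrite !fctE /= [h *: 1]mulr1 [h + t]addrC opprD addrA.
exact.
Qed.

(** Combines the first-order expansions at 0 of the real functions exp, cos
    and sin in exp x (cos y + i sin y) - 1 - (x + i y). *)
Lemma is_derive_cexp0 : is_derive (0 : C) 1 (cexp : C -> C) 1.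
Proof.
apply: is_derive_nrm => e e0.
(* at most six errors of size d |h| occur below, with exp x <= 2 *)
have e6 : 0 < Num.min 1 (e / 6) by rewrite lt_min ltr01 divr_gt0.
set d := Num.min 1 (e / 6) in e6.
have d1 : d <= 1 by rewrite ge_min lexx.
have de : d <= e / 6 by rewrite ge_min lexx orbT.
have he := is_derive_real_near (is_derive_expR (0 : R)) e6.
have hc := is_derive_real_near (is_derive_cos (0 : R)) e6.
have hs := is_derive_real_near (is_derive_sin (0 : R)) e6.
have [r1 r10 H1] := near0_ball he; have [r2 r20 H2] := near0_ball hc.
have [r3 r30 H3] := near0_ball hs.
pose r := Num.min r1 (Num.min r2 r3).
have r0 : 0 < r by rewrite !lt_min r10 r20.
have m0 : 0 < Num.min r (d / 2) by rewrite lt_min r0 divr_gt0.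
apply/nbhs_nrmP; exists (Num.min r (d / 2)) => //.
move=> [x y]; rewrite subr0 lt_min => /andP[hr hd].
have nx := nrm_Re (x +i* y : C); have ny := nrm_Im (x +i* y : C).
have nxy := nrm_ge0 (x +i* y : C).
set n := nrm (x +i* y : C) in hr hd nx ny nxy *.
rewrite /= in nx ny.
move: hr; rewrite /r !lt_min => /andP[hr1 /andP[hr2 hr3]].
have Hx := H1 x (le_lt_trans nx hr1); have Hc := H2 y (le_lt_trans ny hr2).
have Hs := H3 y (le_lt_trans ny hr3).
rewrite add0r expR0 mulr1 in Hx; rewrite add0r cos0 sin0 oppr0 mulr0 subr0 in Hc.
rewrite add0r sin0 cos0 subr0 mulr1 in Hs.
rewrite (le_trans (nrm_le_ReIm _))// cexp0 add0r mulr1.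
have -> : complex.Re (cexp (x +i* y) - 1 - (x +i* y) : C) =
  expR x * (cos y - 1) + (expR x - 1 - x).
  by rewrite /cexp /=; ring.
have -> : complex.Im (cexp (x +i* y) - 1 - (x +i* y) : C) =
  expR x * (sin y - y) + (expR x - 1) * y.
  by rewrite /cexp /=; ring.
have E0 := expR_ge0 x.
set E := expR x in Hx E0 *.
have Hx' : `|E - 1 - x| <= d * n by rewrite (le_trans Hx)// ler_wpM2l// ltW.
have Hc' : `|cos y - 1| <= d * n by rewrite (le_trans Hc)// ler_wpM2l// ltW.
have Hs' : `|sin y - y| <= d * n by rewrite (le_trans Hs)// ler_wpM2l// ltW.
have E1 : `|E - 1| <= d.
  have -> : E - 1 = (E - 1 - x) + x by ring.
  rewrite (le_trans (ler_normD _ _))//; nra.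
have E2 : E <= 2 by have := ler_norm (E - 1); lra.
have t1 : `|E * (cos y - 1)| <= 2 * (d * n).
  by rewrite normrM (ger0_norm E0) ler_pM.
have t2 : `|E * (sin y - y)| <= 2 * (d * n).
  by rewrite normrM (ger0_norm E0) ler_pM.
have t3 : `|(E - 1) * y| <= d * n by rewrite normrM ler_pM.
have := ler_normD (E * (cos y - 1)) (E - 1 - x).
have := ler_normD (E * (sin y - y)) ((E - 1) * y).
by nra.
Qed.

Lemma is_derive_cexp z : is_derive z 1 (cexp : C -> C) (cexp z).
Proof.
have d0 : is_derive (1 * z + - z : C) 1 (cexp : C -> C) 1.
  by rewrite mul1r subrr; exact: is_derive_cexp0.
have := is_derive_cscale (cexp z) (is_derive_comp (is_derive_caffine 1 (- z) z) d0).
move=> /is_derive_ceq; apply=> [w|]; last by rewrite !mulr1.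
by rewrite /= mul1r -cexpD addrC subrK.
Qed.

Lemma is_derive_cexp_comp (f : C -> C) z a : is_derive z 1 f a ->
  is_derive z 1 (fun w => cexp (f w) : C) (a * cexp (f z)).
Proof.
by move=> df; rewrite mulrC; exact: is_derive_comp df (is_derive_cexp (f z)).
Qed.

Lemma cos_eq1 (y : R) : `|y| < 2 * pi -> cos y = 1 -> y = 0.
Proof.
wlog y0 : y / 0 <= y.
  move=> W; case: (leP 0 y) => [/W//|/ltW y0 yp cy].
  by apply: oppr_inj; rewrite oppr0; apply: W; rewrite ?oppr_ge0 ?normrN ?cosN.
rewrite ger0_norm// => yp cy; apply/eqP; rewrite eq_le y0 andbT leNgt.
apply/negP => y_gt0.
have : 0 < sin (y / 2) by apply: sin_gt0_pi; rewrite divr_gt0//= ltr_pdivrMr// mulrC.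
have y2 : y / 2 *+ 2 = y by rewrite -[LHS]mulr_natr divfK.
have := cos_mulr2n (y / 2); rewrite y2 cy cos2sin2 => E.
by move=> s0; have : 0 < sin (y / 2) ^+ 2; [rewrite exprn_gt0|lra].
Qed.

Lemma cexp_inj_strip (a b : C) :
  `|complex.Im (a - b)| < 2 * pi -> cexp a = cexp b -> a = b.
Proof.
move=> ab E; apply: subr0_eq; move: ab.
have : cexp (a - b) = 1 by rewrite cexpD E cexpN mulfV// cexp_neq0.
case: (a - b) => x y; rewrite /cexp /= => /eqP.
rewrite eq_complex /= !mul0r subr0 addr0 => /andP[/eqP h1 /eqP h2] yp.
have E0 := expR_gt0 x.
have s0 : sin y = 0 by move/eqP: h2; rewrite mulf_eq0 gt_eqF//= => /eqP.
have c0 : 0 < cos y by rewrite -(pmulr_rgt0 _ E0) h1.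
have c1 : cos y = 1 by have := cos2Dsin2 y; rewrite s0; nra.
rewrite (cos_eq1 yp c1); move: h1; rewrite c1 mulr1 => /eqP.
by rewrite -expR0 => /eqP/expR_inj ->.
Qed.

(** On the right half-plane the cosine of the argument is positive, which
    confines the argument to ]-pi/2, pi/2[.  This bound is what lets two
    logarithms be compared by [cexp_inj_strip]. *)
Lemma clog_right_half z : 0 < complex.Re z ->
  cexp (clog z) = z /\ `|complex.Im (clog z)| < pi / 2.
Proof.
case: z => x y /= x0.
have n0 : 0 < nrm (x +i* y : C).
  by rewrite (lt_le_trans _ (nrm_Re _))//= normr_gt0 gt_eqF.
rewrite /clog /carg -!/(nrm (x +i* y : C)).
have n2 := nrm_sqr (x +i* y : C); rewrite /= in n2.
set n := nrm _ in n0 n2 *; rewrite /=.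
have xn : x <= n by rewrite -ler_sqr ?nnegrE ?(ltW x0) ?(ltW n0)// n2 lerDl sqr_ge0.
have t0 : 0 < x / n by rewrite divr_gt0.
have t1 : -1 <= x / n <= 1.
  by rewrite ler_pdivrMr// mul1r xn andbT (le_trans _ (ltW t0)).
have ac : cos (acos (x / n)) = x / n by rewrite acosK// in_itv.
have as_ : sin (acos (x / n)) = `|y| / n.
  rewrite sin_acos//.
  have -> : 1 - (x / n) ^+ 2 = (`|y| / n) ^+ 2.
    rewrite !expr_div_n real_normK ?num_real//.
    have -> : y ^+ 2 = n ^+ 2 - x ^+ 2 by rewrite n2; ring.
    by field; rewrite gt_eqF.
  by rewrite sqrtr_sqr ger0_norm// divr_ge0// ltW.
have a0 := acos_ge0 t1; have api := acos_lepi t1.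
have ap2 : acos (x / n) < pi / 2.
  rewrite ltNge; apply/negP => ge.
  have : 0 <= sin (acos (x / n) - pi / 2).
    rewrite sin_ge0_pi// subr_ge0 ge/=; have := pi_ge0 R; lra.
  by rewrite sinBpihalf ac; lra.
split; last by case: ifP => _; rewrite ?normrN ger0_norm.
rewrite /cexp /= lnK//.
by case: leP => hy; rewrite ?cosN ?sinN ac as_;
   apply/eqP; rewrite eq_complex /= !mul0r subr0 addr0 ?(ger0_norm hy) ?(ltr0_norm hy);
   apply/andP; split; apply/eqP; field; rewrite gt_eqF.
Qed.

End ComplexExponential.

(** * Logarithmic and binomial series *)

Section BinomialSeries.
Context {R : realType}.
Local Notation C := R[i]^o.
Implicit Types (b t : nat -> C) (F T : C -> C) (z w a k : C).

Lemma cvgC_unique (u : nat -> C) (l1 l2 : C) :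
  u @ \oo --> l1 -> u @ \oo --> l2 -> l1 = l2.
Proof. by move=> h1 h2; exact: (cvg_unique (@norm_hausdorff _ C) h1 h2). Qed.

Lemma cvg_delta0 a w : series (fun n => a * (n == 0%N)%:R * w ^+ n : C) @ \oo --> a.
Proof.
apply/cvg_nrmP => e e0; exists 1%N => // -[//|n] _ /=.
suff -> : series (fun n => a * (n == 0%N)%:R * w ^+ n : C) n.+1 = a.
  by rewrite subrr nrm0 ltW.
rewrite /series /= big_nat_recl// big1 ?addr0 ?expr0 ?mulr1// => i _.
by rewrite mulr0 mul0r.
Qed.

Lemma pseries_recurrence_identity b t w N :
  (forall n, n.+1%:R * b n.+1 = n%:R * b n + t n) ->
  series (fun n => t n * w ^+ n) N
    - (1 - w) * series (fun n => n.+1%:R * b n.+1 * w ^+ n) N =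
  N%:R * b N * w ^+ N.
Proof.
move=> bt; elim: N => [|N IH].
  by rewrite /series /= !big_geq// mulr0 subrr !mul0r.
rewrite !seriesSr /= mulrDr opprD addrACA IH exprS.
have -> : t N = N.+1%:R * b N.+1 - N%:R * b N by rewrite bt addrC addKr.
ring.
Qed.

(** The coefficient recursion is the differential equation (1 - w) F' = T.
    On partial sums it holds up to N b_N w^N, which tends to 0 as the
    general term of w times the derived series. *)
Lemma pseries_recurrence b t F T (r : R) : r <= 1 ->
  (forall n, n.+1%:R * b n.+1 = n%:R * b n + t n) ->
  (forall w, nrm w < r -> series (fun n => b n * w ^+ n) @ \oo --> F w) ->
  (forall w, nrm w < r -> series (fun n => t n * w ^+ n) @ \oo --> T w) ->
  forall w, nrm w < r -> is_derive w 1 F (T w / (1 - w)).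
Proof.
move=> r1 bt bF tT.
have bF' z : nrm (z - 0) < r -> series (fun n => b n * (z - 0) ^+ n) @ \oo --> F z.
  by rewrite subr0; exact: bF.
have [G GP] := pseries_derive bF'.
move=> w wr; have := GP w; rewrite subr0 => /(_ wr) [cG dG].
have w1 : 1 - w != 0.
  rewrite subr_eq0; apply/eqP => w1; move: (lt_le_trans wr r1).
  by rewrite -w1 nrm1 ltxx.
have c0 : (fun N => w * (N.+1%:R * b N.+1 * w ^+ N) : C) @ \oo --> (w * 0 : C).
  apply: cvgM; first exact: cvg_cst.
  by apply: (@cvg_series_cvg_0 _ C); apply/cvg_ex; exists (G w).
pose S1 := series (fun n => t n * w ^+ n).
pose S2 := series (fun n => n.+1%:R * b n.+1 * w ^+ n).
have c1 : (fun N => S1 N.+1 - (1 - w) * S2 N.+1) @ \oo --> T w - (1 - w) * G w.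
  exact: cvg_succ (cvgB (tT w wr) (cvgM (cvg_cst (1 - w)) cG)).
have E : T w - (1 - w) * G w = w * 0.
  apply: (cvgC_unique c1); apply: cvg_trans c0.
  apply: near_eq_cvg; apply: nearW => N.
  by rewrite /S1 /S2 pseries_recurrence_identity// exprS; ring.
move: E; rewrite mulr0 => /eqP; rewrite subr_eq0 => /eqP ->.
by rewrite mulrC mulKf.
Qed.

(** The function (1 - w) exp (- L w) has zero derivative, hence is constant.
    The crude bound by 2 on the half disk serves only to select the branch of
    the logarithm. *)
Lemma log_series : exists2 L : C -> C, L 0 = 0 & forall w, nrm w < 1 ->
  [/\ series (fun n => - (n%:R)^-1 * w ^+ n) @ \oo --> L w,
      is_derive w 1 L (- (1 - w)^-1),
      cexp (L w) = 1 - w &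
      nrm w <= 2^-1 -> nrm (L w) <= 2].
Proof.
pose b n : C := - (n%:R)^-1.
have bn n : nrm (b n) <= 1.
  by rewrite nrmN nrmV nrm_nat; case: n => [|n]; rewrite ?invr0// invf_le1// ler1n.
have bw w n : nrm (b n * w ^+ n : C) <= 1 * nrm w ^+ n.
  by rewrite nrmM nrmX ler_wpM2r// exprn_ge0// nrm_ge0.
have /choice[L LP] : forall w, exists l : C, nrm w < 1 ->
    series (fun n => b n * w ^+ n) @ \oo --> l.
  move=> w; have [w1|w1] := boolP (nrm w < 1); last by exists 0.
  have [|l] := @cvgC_series_geometric _ (fun n => b n * w ^+ n) (nrm w) 1 _ (bw w).
    by rewrite nrm_ge0.
  by exists l.
have dL w : nrm w < 1 -> is_derive w 1 L (- (1 - w)^-1).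
  move=> w1; rewrite -mulN1r.
  pose t n : C := -1 * (n == 0%N)%:R.
  have rec n : n.+1%:R * b n.+1 = n%:R * b n + t n.
    rewrite /b /t mulrN mulfV ?pnatr_eq0//; case: n => [|n] /=.
      by rewrite mul0r add0r mulr1.
    by rewrite mulr0 addr0 mulrN mulfV ?pnatr_eq0.
  have cT z : nrm z < 1 -> series (fun n => t n * z ^+ n) @ \oo --> (-1 : C).
    by move=> _; exact: cvg_delta0.
  exact: (@pseries_recurrence b t L (fun=> -1) 1 (lexx _) rec LP cT w w1).
have L0 : L 0 = 0.
  have c0 : series (fun n => b n * 0 ^+ n) @ \oo --> L 0 by apply: LP; rewrite nrm0.
  apply: cvgC_unique c0 _; apply/cvg_nrmP => e e0; apply: nearW => N.
  rewrite /series /= big1 ?subrr ?nrm0 ?ltW// => -[|i] _.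
    by rewrite /b invr0 oppr0 mul0r.
  by rewrite expr0n mulr0.
exists L => // w w1; split; [exact: LP|exact: dL| |] .
  have H z : nrm (z - 0) < 1 -> is_derive z 1 (fun w => (-1 * w + 1) * cexp (-1 * L w)) 0.
    rewrite subr0 => z1.
    have z1' : 1 - z != 0.
      by rewrite subr_eq0; apply/eqP => E; move: z1; rewrite -E nrm1 ltxx.
    have d1 := is_derive_caffine (-1 : C) 1 z.
    have d2 := is_derive_cexp_comp (is_derive_cscale (-1) (dL z z1)).
    apply: (is_derive_ceq (is_derive_cmul d1 d2)); first by move=> ?.
    rewrite mulrN !mulN1r opprK [- z + 1]addrC [_ * (_^-1 * _)]mulrA mulfV//.
    by rewrite mul1r addNr.
  have := is_derive0_eq H (_ : nrm (w - 0) < 1).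
  rewrite subr0 L0 !mulr0 add0r cexp0 mulr1 !mulN1r => /(_ w1) E.
  have := cexpN_mul (L w) => E2.
  by rewrite -[RHS]mulr1 -[X in _ = _ * X]E2 mulrA [1 - w]addrC E mul1r.
move=> w2; apply: cvg_nrm_le (LP w w1) _ => N.
have q01 : 0 <= nrm w < 1 by rewrite nrm_ge0.
rewrite (le_trans (nrm_sum _ _ _))// (le_trans (ler_sum _ (fun n _ => bw w n)))//.
rewrite (le_trans (series_geometric_le N q01 ler01))//.
by rewrite ler_pdivrMr ?subr_gt0//; lra.
Qed.


(** The coefficients of (1 - w)^a, that is (-1)^n times the binomial
    coefficient of a over n. *)
Fixpoint binom_coef a (n : nat) : C :=
  if n is k.+1 then (k%:R - a) / k.+1%:R * binom_coef a k else 1.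

Lemma binom_coef_bound a n : nrm (binom_coef a n) <= (1 + nrm a) ^+ n.
Proof.
elim: n => [|n IH] /=; first by rewrite nrm1 expr0.
rewrite exprS nrmM ler_pM ?nrm_ge0// nrmM nrmV nrm_nat.
rewrite ler_pdivrMr ?ltr0Sn// (le_trans (nrmB _ _))// nrm_nat.
by rewrite -natr1; have := nrm_ge0 a; have := ler0n R n; nra.
Qed.

(** The sum B solves (1 - w) B' = - a B, the equation of exp (a L w), so
    that B exp (- a L) is constant.  The radius comes from the
    bound of the coefficients by powers of 1 + |a|. *)
Lemma binomial_series a (L : C -> C) :
  (forall w, nrm w < 1 -> is_derive w 1 L (- (1 - w)^-1)) -> L 0 = 0 ->
  forall w, nrm w < (1 + nrm a)^-1 ->
  series (fun n => binom_coef a n * w ^+ n) @ \oo --> (cexp (a * L w) : C).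
Proof.
move=> dL L0; set r := (1 + nrm a)^-1.
have a1 : 0 < 1 + nrm a by rewrite ltr_pwDl// nrm_ge0.
have r1 : r <= 1 by rewrite invf_le1// lerDl nrm_ge0.
have bw w n : nrm (binom_coef a n * w ^+ n : C) <= 1 * ((1 + nrm a) * nrm w) ^+ n.
  by rewrite nrmM nrmX mul1r exprMn ler_wpM2r ?binom_coef_bound// exprn_ge0// nrm_ge0.
have /choice[B BP] : forall w, exists l : C, nrm w < r ->
    series (fun n => binom_coef a n * w ^+ n) @ \oo --> l.
  move=> w; have [w1|w1] := boolP (nrm w < r); last by exists 0.
  have [|l] := @cvgC_series_geometric _ (fun n => binom_coef a n * w ^+ n)
      ((1 + nrm a) * nrm w) 1 _ (bw w).
    by rewrite mulr_ge0 ?nrm_ge0 ?(ltW a1)//= -ltr_pdivlMl// mulr1.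
  by exists l.
pose t n := - a * binom_coef a n.
have rec n : n.+1%:R * binom_coef a n.+1 = n%:R * binom_coef a n + t n.
  by rewrite /t /= [(_ - _) / _]mulrC !mulrA mulfV ?pnatr_eq0// mul1r mulrBl mulNr.
have tP w : nrm w < r -> series (fun n => t n * w ^+ n) @ \oo --> - a * B w.
  move=> wr; pose S := series (fun n => binom_coef a n * w ^+ n).
  have -> : series (fun n => t n * w ^+ n) = (fun N => - a * S N).
    apply/funext => N; rewrite /S /series /= mulr_sumr; apply: eq_bigr => i _.
    by rewrite /t mulrA.
  exact: cvgM (cvg_cst (- a)) (BP w wr).
have dB := pseries_recurrence r1 rec BP tP.
have B0 : B 0 = 1.
  have c0 : series (fun n => binom_coef a n * 0 ^+ n) @ \oo --> B 0.
    by apply: BP; rewrite nrm0 invr_gt0.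
  apply: (cvgC_unique c0).
  have -> : (fun n => binom_coef a n * 0 ^+ n) = (fun n => 1 * (n == 0%N)%:R * 0 ^+ n).
    by apply/funext => -[|n]; rewrite ?expr0 ?mulr1// !expr0n !mulr0.
  exact: cvg_delta0.
move=> w wr; suff <- : B w = cexp (a * L w) by exact: BP.
have H z : nrm (z - 0) < r -> is_derive z 1 (fun w => B w * cexp (- a * L w)) 0.
  rewrite subr0 => zr.
  have d1 := dB z zr.
  have d2 := is_derive_cexp_comp (is_derive_cscale (- a) (dL z (lt_le_trans zr r1))).
  apply: (is_derive_ceq (is_derive_cmul d1 d2)); first by move=> ?.
  ring.
have := is_derive0_eq H (_ : nrm (w - 0) < r).
rewrite subr0 B0 L0 mulr0 cexp0 mulr1 => /(_ wr) E.
have := cexpN_mul (a * L w) => E2.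
by rewrite -[LHS]mulr1 -[X in _ * X = _]E2 mulrA -mulNr E mul1r.
Qed.

End BinomialSeries.

(** * The extremal function *)

Section ExtremalFunction.
Context {R : realType}.
Local Notation C := R[i]^o.
Implicit Types (x y z w a b k : C).

Lemma one_sub_Re_gt0 x : nrm x < 1 -> 0 < complex.Re (1 - x).
Proof.
have := nrm_Re x; case: x => u v /= h1 h2.
by have := ler_norm u; lra.
Qed.

Lemma one_sub_neq0 x : nrm x < 1 -> 1 - x != 0.
Proof. by move=> /one_sub_Re_gt0; apply: contraTneq => ->; rewrite ltxx. Qed.

(** Both sides are logarithms of 1 - y = (1 - x) (1 - w) with
    w = (y - x) / (1 - x), and their imaginary parts differ by less than
    pi/2 + pi/2 + 2 <= 2 pi. *)
Lemma clog_one_sub_add (L : C -> C) x y :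
  (forall w, nrm w < 1 -> cexp (L w) = 1 - w /\
     (nrm w <= 2^-1 -> nrm (L w) <= 2)) ->
  nrm x < 1 -> nrm y < 1 -> nrm ((y - x) / (1 - x) : C) <= 2^-1 ->
  clog (1 - y) = clog (1 - x) + L ((y - x) / (1 - x)).
Proof.
move=> LP x1 y1; set w : C := _ / _ => w2.
have [|eL /(_ w2) bL] := LP w; first by rewrite (le_lt_trans w2)// invf_lt1 ?ltr1n.
have [ex bx] := clog_right_half (one_sub_Re_gt0 x1).
have [ey by_] := clog_right_half (one_sub_Re_gt0 y1).
apply: cexp_inj_strip; last first.
  rewrite cexpD ex ey eL /w mulrBr mulr1 mulrCA mulfV ?one_sub_neq0// mulr1.
  by ring.
have bI : `|complex.Im (L w)| <= 2 by rewrite (le_trans (nrm_Im _)).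
move: bx by_ bI; case: (clog (1 - x)) (clog (1 - y)) (L w) => [? p] [? q] [? s] /=.
have := pi_ge2 R; rewrite !ltr_norml !ler_norml => ? /andP[? ?] /andP[? ?] /andP[? ?].
by apply/andP; split; lra.
Qed.

Lemma one_sub_quotient_near x : nrm x < 1 -> exists2 r : R, 0 < r &
  forall y, nrm (y - x) < r -> nrm y < 1 /\ nrm ((y - x) / (1 - x) : C) <= 2^-1.
Proof.
move=> x1; have n0 : 0 < nrm (1 - x) by rewrite nrm_gt0 one_sub_neq0.
exists (Num.min (1 - nrm x) (nrm (1 - x) / 2)).
  by rewrite lt_min subr_gt0 x1 divr_gt0.
move=> y; rewrite lt_min => /andP[h1 h2]; split.
  have -> : y = (y - x) + x by rewrite subrK.
  by rewrite (le_lt_trans (nrmD _ _))//; lra.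
by rewrite nrmM nrmV ler_pdivrMr// mulrC ltW.
Qed.

Lemma is_derive_clog_one_sub x : nrm x < 1 ->
  is_derive x 1 (fun y : C => clog (1 - y) : C) (- (1 - x)^-1).
Proof.
move=> x1; have [L L0 LP] := @log_series R.
have [r r0 rP] := one_sub_quotient_near x1.
pose k := (1 - x)^-1.
have d0 : is_derive (k * x + - (x * k) : C) 1 L (-1).
  rewrite [k * x]mulrC subrr.
  by have [|_ + _ _] := LP 0; rewrite ?nrm0// subr0 invr1.
have d1 := is_derive_comp (is_derive_caffine k (- (x * k)) x) d0.
have d2 := is_derive_cadd (is_derive_ccst (clog (1 - x)) x) d1.
have -> : - (1 - x)^-1 = 0 + (-1) * k by rewrite add0r mulN1r.
apply: near_eq_is_derive d2.
apply/nbhs_nrmP; exists r => // y /rP[y1 yq] /=.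
have LP' w : nrm w < 1 -> cexp (L w) = 1 - w /\ (nrm w <= 2^-1 -> nrm (L w) <= 2).
  by move=> /LP[].
rewrite (clog_one_sub_add LP' x1 y1 yq).
by congr (_ + L _); rewrite /k; ring.
Qed.

(** Composing a power series with an affine map centred at [x], and then
    with another affine map, only rescales its coefficients and shifts the
    constant one. *)
Lemma analytic_at_affine (c : nat -> C) (F f : C -> C) (rho r : R) x k a b :
  0 < rho -> 0 < r ->
  (forall w, nrm w < rho -> series (fun n => c n * w ^+ n) @ \oo --> F w) ->
  (forall y, nrm (y - x) < r -> f y = a + b * F (k * (y - x))) ->
  exists (c' : nat -> C) (r' : R), 0 < r' /\ forall y, `|y - x| < r'%:C ->
    series (fun n => c' n * (y - x) ^+ n) @ \oo --> f y.
Proof.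
move=> rho0 r0 cF fF.
have k1 : 0 < nrm k + 1 by rewrite ltr_wpDl ?nrm_ge0.
exists (fun n => a * (n == 0%N)%:R + b * (c n * k ^+ n)), (Num.min r (rho / (nrm k + 1))).
split=> [|y]; first by rewrite lt_min r0 divr_gt0.
rewrite nrmE ltcR lt_min => /andP[yr yrho]; rewrite fF//.
have kr : nrm (k * (y - x) : C) < rho.
  move: yrho; rewrite ltr_pdivlMr// => /(le_lt_trans _); apply.
  by rewrite nrmM mulrC ler_wpM2l ?nrm_ge0// lerDl.
have -> : series (fun n => (a * (n == 0%N)%:R + b * (c n * k ^+ n)) * (y - x) ^+ n) =
    (fun N => series (fun n => a * (n == 0%N)%:R * (y - x) ^+ n) N +
      b * series (fun n => c n * (k * (y - x)) ^+ n) N).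
  apply/funext => N; rewrite /series /= mulr_sumr -big_split /=.
  by apply: eq_bigr => n _; rewrite exprMn; ring.
have h1 := @cvg_delta0 R a (y - x); have h2 := cF _ kr.
pose S2 N : C := b * series (fun n => c n * (k * (y - x)) ^+ n) N.
have {}h2 : S2 @ \oo --> b * F (k * (y - x)) by exact: cvgM (cvg_cst b) h2.
exact: (cvgD h1 h2).
Qed.

Context (alpha : R).

(** The power (1 - y)^(2 alpha - 2), which on the unit disk is the derivative
    of [hfun alpha] in both cases of its definition. *)
Definition hfun' (y : C) : C := cexp ((2 * alpha - 2)%:C * clog (1 - y)).

Lemma hfun_analytic : analytic_on U (hfun alpha).
Proof.
suff H (x : C) : nrm x < 1 -> exists (c : nat -> C) (r : R), 0 < r /\
    forall z : C, `|z - x| < r%:C ->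
      series (fun n => c n * (z - x) ^+ n) @ \oo --> hfun alpha z.
  by move=> x Ux; apply: H; move: Ux; rewrite /U /unit_ball /= nrmE ltcR.
move=> x1.
have [L L0 LP] := @log_series R.
have [r r0 rP] := one_sub_quotient_near x1.
have LP' w : nrm w < 1 -> cexp (L w) = 1 - w /\ (nrm w <= 2^-1 -> nrm (L w) <= 2).
  by move=> /LP[].
have kE y : (1 - x)^-1 * (y - x) = (y - x) / (1 - x) by rewrite mulrC.
have [a2|a2] := eqVneq alpha 2^-1.
  have cL w : nrm w < 1 -> series (fun n => - (n%:R)^-1 * w ^+ n) @ \oo --> L w.
    by move=> /LP[].
  apply: (@analytic_at_affine _ L (hfun alpha) 1 r x (1 - x)^-1
    (- clog (1 - x)) (-1) ltr01 r0 cL).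
  move=> y /rP[y1 yq]; rewrite /hfun a2 eqxx kE.
  by rewrite (clog_one_sub_add LP' x1 y1 yq) mulN1r opprD.
pose p : C := (2 * alpha - 1)%:C.
have dL w : nrm w < 1 -> is_derive w 1 L (- (1 - w)^-1) by move=> /LP[].
have B := @binomial_series _ p L dL L0.
have rho0 : 0 < (1 + nrm p)^-1 by rewrite invr_gt0 ltr_pwDl// nrm_ge0.
apply: (@analytic_at_affine _ _ (hfun alpha) _ r x (1 - x)^-1 p^-1
  (- cexp (p * clog (1 - x)) / p) rho0 r0 B).
move=> y /rP[y1 yq]; rewrite /hfun (negPf a2) -/p kE /cpow.
rewrite (clog_one_sub_add LP' x1 y1 yq) mulrDr cexpD.
by ring.
Qed.

Lemma hfun'E x : nrm x < 1 ->
  hfun' x = cexp ((2 * alpha - 1)%:C * clog (1 - x)) / (1 - x).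
Proof.
move=> x1; have [ex _] := clog_right_half (one_sub_Re_gt0 x1).
rewrite -[X in _ / X]ex -cexpN -cexpD /hfun'; congr cexp.
have -> : 2 * alpha - 2 = (2 * alpha - 1) - 1 by ring.
by rewrite rmorphB rmorph1 mulrBl mul1r.
Qed.

Lemma is_derive_hfun x : nrm x < 1 -> is_derive x 1 (hfun alpha) (hfun' x).
Proof.
move=> x1; have dl := is_derive_clog_one_sub x1; rewrite hfun'E//.
have [a2|a2] := eqVneq alpha 2^-1.
  apply: (is_derive_ceq (is_derive_cscale (-1) dl)) => [y|].
    by rewrite /hfun a2 eqxx mulN1r.
  have -> : 2 * alpha - 1 = 0 by rewrite a2 mulfV ?subrr.
  by rewrite rmorph0 mul0r cexp0 mul1r mulN1r opprK.
pose p : C := (2 * alpha - 1)%:C.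
have p0 : p != 0.
  rewrite -(rmorph0 (real_complex R)) (inj_eq (@complexI R)) subr_eq0.
  by apply: contraNneq a2 => E; apply/eqP; lra.
have d1 := is_derive_cexp_comp (is_derive_cscale p dl).
have d2 := is_derive_cadd (is_derive_ccst p^-1 x) (is_derive_cscale (- p^-1) d1).
apply: (is_derive_ceq d2) => [y|].
  by rewrite /hfun (negPf a2) /cpow -/p; ring.
rewrite -/p add0r; move: (cexp _) => E.
by rewrite !(mulrN, mulNr) opprK !mulrA mulVf// mul1r [RHS]mulrC.
Qed.

Lemma is_derive_hfun' x : nrm x < 1 ->
  is_derive x 1 hfun' ((2 - 2 * alpha)%:C / (1 - x) * hfun' x).
Proof.
move=> x1; have dl := is_derive_clog_one_sub x1.
have d1 := is_derive_cexp_comp (is_derive_cscale (2 * alpha - 2)%:C dl).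
apply: (is_derive_ceq d1) => [y|]; first by [].
rewrite /hfun'; move: (cexp _) => E.
have -> : (2 - 2 * alpha)%:C = - (2 * alpha - 2)%:C by rewrite -rmorphN opprB.
by rewrite mulrN [in RHS]mulNr.
Qed.

End ExtremalFunction.

(** * Orthonormal families *)

Section OrthonormalFamily.
Context {R : realType} {X : normedModType R[i]} (ip : {dot X for Num.conj}).
Hypothesis ip_norm : forall x : X, ip x x = `|x| ^+ 2.
Local Notation C := R[i]^o.

Lemma ipDl x y z : ip (x + y) z = ip x z + ip y z.
Proof. exact: linearDl. Qed.

Lemma ipZl (a : C) x z : ip (a *: x) z = a * ip x z.
Proof. exact: linearZl_LR. Qed.

Lemma ipBl x y z : ip (x - y) z = ip x z - ip y z.
Proof. exact: linearBl. Qed.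

Lemma ipC x y : ip y x = (ip x y)^*%C.
Proof. by rewrite (@hermC _ _ _ _ ip y x) expr0 mul1r. Qed.

Lemma ip0l z : ip 0 z = 0.
Proof. exact: linear0l. Qed.

Lemma ip_suml (I : Type) (r : seq I) (P : pred I) (F : I -> X) z :
  ip (\sum_(i <- r | P i) F i) z = \sum_(i <- r | P i) ip (F i) z.
Proof. exact: linear_sumlz. Qed.

Lemma nrm2_ip x : (nrm x ^+ 2)%:C = ip x x.
Proof. by rewrite ip_norm nrmE rmorphXn. Qed.

Lemma ip_eq0_sym x y : ip x y = 0 -> ip y x = 0.
Proof. by move=> xy; rewrite ipC xy conjc0. Qed.

Lemma pythagoras x y : ip x y = 0 -> nrm (x + y) ^+ 2 = nrm x ^+ 2 + nrm y ^+ 2.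
Proof.
move=> xy; apply: complexI; rewrite rmorphD /= !nrm2_ip ipDl.
rewrite (ipC (x + y) x) (ipC (x + y) y) !ipDl xy (ip_eq0_sym xy).
by rewrite addr0 add0r -!ipC.
Qed.

Context {m : nat} (u : 'I_m -> X).
Hypothesis u_unit : forall j, `|u j| = 1.
Hypothesis u_orth : forall j k, j != k -> ip (u j) (u k) = 0.
Implicit Types (a b c : 'I_m -> C) (j k : 'I_m).

Lemma nrm_u j : nrm (u j) = 1.
Proof. by rewrite /nrm u_unit. Qed.

Lemma ip_u j k : ip (u j) (u k) = (j == k)%:R.
Proof.
by have [<-|/u_orth//] := eqVneq j k; rewrite ip_norm u_unit expr1n.
Qed.

Lemma ip_comb a k : ip (\sum_j a j *: u j) (u k) = a k.
Proof.
rewrite ip_suml (bigD1 k)//= big1 ?addr0 => [|j jk]; rewrite ipZl ip_u.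
  by rewrite eqxx mulr1.
by rewrite (negPf jk) mulr0.
Qed.

Lemma nrm2_comb a : nrm (\sum_j a j *: u j) ^+ 2 = \sum_j nrm (a j) ^+ 2.
Proof.
apply: complexI; rewrite nrm2_ip {1}ip_suml rmorph_sum; apply: eq_bigr => j _.
rewrite ipZl (ipC (\sum_j a j *: u j)) ip_comb rmorphXn -sqr_normc.
exact: (congr1 (fun x => x ^+ 2) (nrmE (a j))).
Qed.

Lemma bessel x : \sum_j nrm (ip x (u j) : C) ^+ 2 <= nrm x ^+ 2.
Proof.
pose a j : C := ip x (u j); pose s := \sum_j a j *: u j.
have rs : ip (x - s) s = 0.
  rewrite ipC ip_suml big1 ?conjc0// => j _; rewrite ipZl.
  have -> : ip (u j) (x - s) = 0; last by rewrite mulr0.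
  by apply: ip_eq0_sym; rewrite ipBl ip_comb subrr.
have := pythagoras rs; rewrite subrK nrm2_comb => ->.
by rewrite lerDr sqr_ge0.
Qed.

Lemma nrm_ip_le x j : nrm (ip x (u j) : C) <= nrm x.
Proof.
rewrite -ler_sqr ?nnegrE ?nrm_ge0// (le_trans _ (bessel x))//.
by rewrite (bigD1 j)//= lerDl sumr_ge0// => k _; rewrite sqr_ge0.
Qed.

Lemma ip_comb_l a x : ip (\sum_j a j *: u j) x = \sum_j a j * (ip x (u j))^*%C.
Proof.
by rewrite ip_suml; apply: eq_bigr => j _; rewrite ipZl (ipC x).
Qed.

Lemma nrm_comb_le a (K : R) : (forall j, nrm (a j) <= K) ->
  nrm (\sum_j a j *: u j) <= m%:R * K.
Proof.
move=> aK; rewrite (le_trans (nrm_sum _ _ _))//.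
rewrite (le_trans (ler_sum _ (_ : forall j, _ -> _ <= K)))//.
  by move=> j _; rewrite nrmZ nrm_u mulr1.
by rewrite sumr_const card_ord mulr_natl.
Qed.

(** The diagonal operator with entries [c] on the family and the identity on
    its orthogonal complement.  In this form composition and inversion act on
    the entries. *)
Definition diag_op c (y : X) : X := y + \sum_j ((c j - 1) * ip y (u j)) *: u j.

Lemma ip_diag_op c y k : ip (diag_op c y) (u k) = c k * ip y (u k).
Proof. by rewrite ipDl ip_comb mulrBl mul1r addrC subrK. Qed.

Lemma diag_op_linear c : linear (diag_op c).
Proof.
move=> k x y; rewrite /diag_op scalerDr addrACA scaler_sumr -big_split /=.
congr (_ + _); apply: eq_bigr => j _; rewrite scalerA -scalerDl ipDl ipZl.
by congr (_ *: _); ring.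
Qed.

Lemma diag_op_bounded c : exists M : R, forall y, nrm (diag_op c y) <= M * nrm y.
Proof.
exists (1 + \sum_j nrm (c j - 1)) => y.
rewrite (le_trans (nrmD _ _))// mulrDl mul1r lerD2l.
rewrite (le_trans (nrm_sum _ _ _))// mulr_suml; apply: ler_sum => j _.
by rewrite nrmZ nrm_u mulr1 nrmM ler_wpM2l ?nrm_ge0// nrm_ip_le.
Qed.

Lemma diag_op_comp b c y : diag_op b (diag_op c y) = diag_op (fun j => b j * c j) y.
Proof.
rewrite {1}/diag_op /diag_op -addrA -big_split /=; congr (_ + _).
apply: eq_bigr => j _; rewrite -/(diag_op c y) ip_diag_op -scalerDl.
by congr (_ *: _); ring.
Qed.

Lemma diag_op1 c y : (forall j, c j = 1) -> diag_op c y = y.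
Proof.
move=> c1; rewrite /diag_op big1 ?addr0// => j _.
by rewrite c1 subrr mul0r scale0r.
Qed.

Lemma diag_op_comb c a :
  diag_op c (\sum_j a j *: u j) = \sum_j (c j * a j) *: u j.
Proof.
rewrite /diag_op -big_split /=; apply: eq_bigr => j _.
by rewrite -scalerDl ip_comb; congr (_ *: _); ring.
Qed.

End OrthonormalFamily.

(** * Inverse function theorem *)

Section StrictDifferentiability.
Context {R : realType} {X Y : normedModType R[i]}.

Definition bounded_map (L : X -> Y) := exists M : R, forall h, nrm (L h) <= M * nrm h.

(** Unlike differentiability, this controls f x - f y for all pairs of
    points near [z]; the map x |-> x + L^-1 (y - f x) is then a contraction. *)
Definition strict_diff (f : X -> Y) (z : X) (L : X -> Y) :=
  forall e : R, 0 < e -> exists2 d : R, 0 < d & forall x y,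
    nrm (x - z) < d -> nrm (y - z) < d ->
    nrm (f x - f y - L (x - y)) <= e * nrm (x - y).

Lemma strict_diff_diff (f : X -> Y) z L : linear L -> bounded_map L ->
  strict_diff f z L -> differentiable f z /\ forall h, 'd f z h = L h.
Proof.
move=> linL bL sf; apply: diff_nrm => // e /sf[d d0 H].
apply/nbhs_nrmP; exists d => // h; rewrite subr0 => hd.
have -> : L h = L (z + h - z) by rewrite addrC addKr.
have {3}-> : h = z + h - z by rewrite addrC addKr.
by apply: H; rewrite ?subrr ?nrm0// addrC addKr.
Qed.

Lemma bounded_map_gt0 (L : X -> Y) : bounded_map L ->
  exists2 M : R, 0 < M & forall h, nrm (L h) <= M * nrm h.
Proof.
move=> [M LM]; exists (`|M| + 1) => [|h]; first by rewrite ltr_wpDl.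
rewrite (le_trans (LM h))// ler_wpM2r ?nrm_ge0//.
by rewrite (le_trans (ler_norm M))// lerDl.
Qed.

End StrictDifferentiability.

Lemma cvg_half_geometric (R : realType) (X : completeNormedModType R[i])
    (v : nat -> X) (M : R) :
  (forall n, nrm (v n.+1 - v n) <= M * 2^-1 ^+ n) -> exists l : X, v @ \oo --> l.
Proof.
move=> vM; have M0 : 0 <= M.
  by have := vM 0%N; rewrite mulr1; apply: le_trans; exact: nrm_ge0.
have tail n k : nrm (v (n + k)%N - v n) <= 2 * M * (2^-1 ^+ n - 2^-1 ^+ (n + k)).
  elim: k => [|k IH]; first by rewrite addn0 !subrr nrm0 mulr0.
  have -> : v (n + k.+1)%N - v n = (v (n + k).+1 - v (n + k)%N) + (v (n + k)%N - v n).
    by rewrite addnS addrA subrK.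
  rewrite (le_trans (nrmD _ _))// (le_trans (lerD (vM _) IH))//.
  by rewrite addnS exprS; lra.
suff : cvgn v by move/cvg_ex.
apply/cauchy_cvgP/cauchy_exP => e e0; have [d d0 ->] := posc_ex e0.
have h0 : (fun n => 2 * M * 2^-1 ^+ n : R) @ \oo --> 2 * M * 0.
  apply: cvgM; first exact: cvg_cst.
  by apply: cvg_expr; rewrite ger0_norm// invf_lt1// ltr1n.
have [N _ HN] : \forall n \near \oo, 2 * M * 2^-1 ^+ n < d.
  by rewrite mulr0 in h0; move/cvgr_lt : h0; apply.
exists (v N); exists N => // n /= Nn.
rewrite -ball_normE /= distrC nrmE ltcR.
apply: le_lt_trans (HN N (leqnn N)).
rewrite -(subnKC Nn) (le_trans (tail _ _))// ler_wpM2l ?mulr_ge0//.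
by rewrite gerBl exprn_ge0// invr_ge0.
Qed.

Lemma linear_fun_sub (K : pzRingType) (V W : lmodType K) (L : V -> W) :
  linear L -> {morph L : x y / x - y}.
Proof. by move=> linL x y; rewrite addrC -scaleN1r linL scaleN1r addrC. Qed.

Section InverseFunctionTheorem.
Context {R : realType} {X : completeNormedModType R[i]}.
Implicit Types (f L Li : X -> X) (z : X).

(** The iterates of [x0] stay in the closed ball: the first step moves the
    centre by at most r / 2, and [T] halves distances. *)
Lemma contraction_fixpoint_near (T : X -> X) (x0 : X) (r : R) :
  0 < r -> nrm (T x0 - x0) <= r / 2 ->
  (forall x y, nrm (x - x0) <= r -> nrm (y - x0) <= r ->
    nrm (T x - T y) <= 2^-1 * nrm (x - y)) ->
  exists2 x, nrm (x - x0) <= r & T x = x.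
Proof.
move=> r0 T0 cT; pose v n := iter n T x0.
have x0r : nrm (x0 - x0) <= r by rewrite subrr nrm0 ltW.
have stay x : nrm (x - x0) <= r -> nrm (T x - x0) <= r.
  move=> xr; have -> : T x - x0 = (T x - T x0) + (T x0 - x0) by rewrite addrA subrK.
  rewrite (le_trans (nrmD _ _))//; have := cT x x0 xr x0r; lra.
have vr n : nrm (v n - x0) <= r by elim: n => [|n IH] //=; exact: stay.
have vM n : nrm (v n.+1 - v n) <= r / 2 * 2^-1 ^+ n.
  elim: n => [|n IH]; first by rewrite expr0 mulr1.
  rewrite (le_trans (cT _ _ (vr n.+1) (vr n)))// exprS mulrCA.
  by rewrite ler_wpM2l// invr_ge0.
have [l /cvg_nrmP vl] := cvg_half_geometric vM.
have lr : nrm (l - x0) <= r.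
  apply/ler_addgt0Pr => e /vl[N _ /(_ N (leqnn N)) /= H].
  have -> : l - x0 = (v N - x0) - (v N - l) by rewrite opprB [RHS]addrC addrA subrK.
  by rewrite (le_trans (nrmB _ _))// lerD.
exists l => //; apply/subr0_eq/eqP; rewrite -nrm_eq0 eq_le nrm_ge0 andbT.
apply/ler_addgt0Pr => e e0; rewrite add0r.
have /vl[N _ H] : 0 < e / 2 by rewrite divr_gt0.
have H1 := H N (leqnn N); have H2 := H N.+1 (leqnSn N); rewrite /= in H1 H2.
have -> : T l - l = - (v N.+1 - T l) + (v N.+1 - l) by rewrite opprB addrA subrK.
rewrite (le_trans (nrmD _ _))// nrmN.
have := cT (v N) l (vr N) lr; rewrite -[T (v N)]/(v N.+1); lra.
Qed.

(** A perturbation of an invertible linear map by at most half of its lower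
    bound stays injective, with a Lipschitz inverse. *)
Lemma strict_diff_lower_bound f z L Li (M d : R) : 0 < M -> linear L ->
  (forall h, Li (L h) = h) -> (forall h, nrm (Li h) <= M * nrm h) ->
  (forall x y, nrm (x - z) < d -> nrm (y - z) < d ->
    nrm (f x - f y - L (x - y)) <= (2 * M)^-1 * nrm (x - y)) ->
  forall x y, nrm (x - z) < d -> nrm (y - z) < d ->
    nrm (x - y) <= 2 * M * nrm (f x - f y).
Proof.
move=> M0 linL LiL LiM fd x y xd yd; have := fd x y xd yd.
set k := x - y => H.
have H1 : nrm k <= M * nrm (L k) by rewrite -{1}(LiL k).
have H2 : nrm (L k) <= nrm (f x - f y) + nrm (f x - f y - L k).
  have {1}-> : L k = (f x - f y) - (f x - f y - L k) by rewrite opprB addrC subrK.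
  exact: nrmB.
have H3 : M * nrm (f x - f y - L k) <= nrm k / 2.
  apply: le_trans (ler_wpM2l (ltW M0) H) _.
  by rewrite invfM mulrA mulrCA mulfV ?gt_eqF// mulr1 mulrC.
nra.
Qed.

(** Preimages of [y] are the fixed points of x |-> x + Li (y - f x), a
    contraction of a closed ball around [x0] once [y] is close to [f x0]. *)
Lemma strict_diff_open_image f z L Li (M d : R) : 0 < M ->
  (forall h, L (Li h) = h) -> (forall h, Li (L h) = h) -> linear Li -> L 0 = 0 ->
  (forall h, nrm (Li h) <= M * nrm h) ->
  (forall x y, nrm (x - z) < d -> nrm (y - z) < d ->
    nrm (f x - f y - L (x - y)) <= (2 * M)^-1 * nrm (x - y)) ->
  open (f @` [set x | nrm (x - z) < d]).
Proof.
move=> M0 LLi LiL linLi L0 LiM fd.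
have LiB := linear_fun_sub linLi.
rewrite openE => _ [x0 /= x0d <-]; apply/nbhs_nrmP.
pose r := (d - nrm (x0 - z)) / 2.
have r0 : 0 < r by rewrite divr_gt0// subr_gt0.
exists (r / (2 * M)) => [|y yr]; first by rewrite divr_gt0// mulr_gt0.
have inV x : nrm (x - x0) <= r -> nrm (x - z) < d.
  move=> xr; have -> : x - z = (x - x0) + (x0 - z) by rewrite addrA subrK.
  by rewrite (le_lt_trans (nrmD _ _))//; rewrite /r in xr; lra.
pose T x := x + Li (y - f x).
have T0 : nrm (T x0 - x0) <= r / 2.
  rewrite /T addrC addKr (le_trans (LiM _))//.
  move: yr; rewrite ltr_pdivlMr ?mulr_gt0// => yr; lra.
have cT x x' : nrm (x - x0) <= r -> nrm (x' - x0) <= r ->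
    nrm (T x - T x') <= 2^-1 * nrm (x - x').
  move=> xr xr'.
  have -> : T x - T x' = - Li (f x - f x' - L (x - x')).
    rewrite /T !LiB LiL; move: (Li (f x)) (Li (f x')) (Li y) => a b c.
    rewrite opprD addrACA [in RHS]opprB; congr (_ + _).
    by rewrite !opprB [LHS]addrC addrA subrK.
  rewrite nrmN (le_trans (LiM _))//.
  apply: le_trans (ler_wpM2l (ltW M0) (fd _ _ (inV _ xr) (inV _ xr'))) _.
  by rewrite mulrA invfM mulrCA mulfV ?gt_eqF// mulr1.
have [x xr Tx] := contraction_fixpoint_near r0 T0 cT.
exists x; first exact: inV.
have : Li (y - f x) = 0.
  by move/(congr1 (fun w => w - x)): Tx; rewrite /T addrC addKr subrr.
move=> /(congr1 L); rewrite LLi L0 => /eqP; rewrite subr_eq0 => /eqP ->.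
by [].
Qed.

(** On a small ball around [z] the mapping is injective with Lipschitz
    inverse and open image.  The Lipschitz bound turns the strict
    differentiability of [f] at any point of that ball into differentiability of
    the inverse at the image point. *)
Theorem strict_diff_locally_biholomorphic (f : X -> X) (A : set X) (L Li : X -> X -> X) :
  open A ->
  (forall z, A z -> [/\ strict_diff f z (L z), linear (L z) & bounded_map (L z)]) ->
  (forall z, A z -> linear (Li z) /\ bounded_map (Li z)) ->
  (forall z, A z -> (forall h, L z (Li z h) = h) /\ (forall h, Li z (L z h) = h)) ->
  locally_biholomorphic A f.
Proof.
move=> oA fL bLi LLi z Az.
have [sf linL bL] := fL z Az; have [linLi /bounded_map_gt0[M M0 LiM]] := bLi z Az.
have [LLiz LiLz] := LLi z Az.
have e0 : 0 < (2 * M)^-1 by rewrite invr_gt0 mulr_gt0.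
have [d1 d10 fd1] := sf _ e0.
have [d2 d20 Ad2] : exists2 d : R, 0 < d & forall x, nrm (x - z) < d -> A x.
  by apply/nbhs_nrmP; exact: open_nbhs_nbhs.
pose d := Num.min d1 d2; pose V := [set x : X | nrm (x - z) < d].
have d0 : 0 < d by rewrite lt_min d10.
have fd x y : nrm (x - z) < d -> nrm (y - z) < d ->
    nrm (f x - f y - L z (x - y)) <= (2 * M)^-1 * nrm (x - y).
  by rewrite !lt_min => /andP[? _] /andP[? _]; exact: fd1.
have VA x : V x -> A x by rewrite /V /= lt_min => /andP[_]; exact: Ad2.
have oV : open V.
  rewrite openE => x Vx; apply/nbhs_nrmP; exists (d - nrm (x - z)).
    by rewrite subr_gt0.
  move=> y yx; rewrite /V /=; have -> : y - z = (y - x) + (x - z) by rewrite addrA subrK.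
  by rewrite (le_lt_trans (nrmD _ _))// -ltrBrDr.
have low := strict_diff_lower_bound M0 linL LiLz LiM fd.
have L0 : L z 0 = 0.
  by have := linL (-1) 0 0; rewrite scaler0 addr0 scaleN1r addNr.
have ofV := strict_diff_open_image M0 LLiz LiLz linLi L0 LiM fd.
have finj x y : V x -> V y -> f x = f y -> x = y.
  move=> Vx Vy fxy; apply/subr0_eq/eqP; rewrite -nrm_eq0 eq_le nrm_ge0 andbT.
  by rewrite (le_trans (low _ _ Vx Vy))// fxy subrr nrm0 mulr0.
pose g y := xget z [set x | V x /\ f x = y].
have gf x : V x -> g (f x) = x.
  move=> Vx; rewrite /g; case: xgetP => [y _ [Vy fy]|/(_ x)[]//].
  exact: finj.
exists V; split => //; first by rewrite /V /= subrr nrm0.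
split=> //.
  move=> x /VA Ax; have [sfx linLx bLx] := fL x Ax.
  by have [] := strict_diff_diff linLx bLx sfx.
exists g => // _ [x Vx <-].
have Ax := VA x Vx; have [sfx linLx bLx] := fL x Ax.
have [linLix bLix] := bLi x Ax; have [LLix LiLx] := LLi x Ax.
apply: (proj1 (@diff_nrm _ _ _ g (Li x) (f x) linLix bLix _)) => e ep.
have [N N0 LiN] := bounded_map_gt0 bLix.
(* [N] bounds the inverse differential at [x] and 2 M the Lipschitz constant of [g] *)
have ep' : 0 < e / (N * (2 * M)) by rewrite divr_gt0// !mulr_gt0.
have [d3 d30 fd3] := sfx _ ep'.
have : nbhs (f x) (f @` V) by apply: open_nbhs_nbhs; split => //; exists x.
move=> /nbhs_nrmP[d4 d40 fV4].
apply/nbhs_nrmP; exists (Num.min d4 (d3 / (2 * M))).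
  by rewrite lt_min d40 divr_gt0// mulr_gt0.
move=> k; rewrite subr0 lt_min ltr_pdivlMr ?mulr_gt0// => /andP[k4 k3].
have [|x' Vx' fx'] := fV4 (f x + k); first by rewrite addrC addKr.
have kE : k = f x' - f x by rewrite fx' addrC addKr.
rewrite -fx' !gf//.
have lowx := low _ _ Vx' Vx; rewrite -kE in lowx.
have x'd3 : nrm (x' - x) < d3 by rewrite (le_lt_trans lowx)// mulrC.
have H := fd3 x' x x'd3 (_ : nrm (x - x) < d3); rewrite -kE subrr nrm0 in H.
have -> : x' - x - Li x k = - Li x (k - L x (x' - x)).
  by rewrite (linear_fun_sub linLix) LiLx opprB.
rewrite nrmN (le_trans (LiN _))//.
apply: le_trans (ler_wpM2l (ltW N0) (H d30)) _.
apply: le_trans (ler_wpM2l (ltW N0) (ler_wpM2l (ltW ep') lowx)) _.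
rewrite le_eqVlt; apply/orP; left; apply/eqP; field.
by rewrite !gt_eqF.
Qed.

End InverseFunctionTheorem.

(** * First and second differentials of Phi *)

Lemma unit_ballE (R : realType) (X : normedModType R[i]) (z : X) :
  unit_ball X z <-> nrm z < 1.
Proof. by rewrite /unit_ball /= nrmE ltcR. Qed.

Lemma open_unit_ball (R : realType) (X : normedModType R[i]) : open (unit_ball X).
Proof.
rewrite openE => z /unit_ballE z1; apply/nbhs_nrmP; exists (1 - nrm z).
  by rewrite subr_gt0.
move=> w wz; apply/unit_ballE; have -> : w = (w - z) + z by rewrite subrK.
by rewrite (le_lt_trans (nrmD _ _))// -ltrBrDr.
Qed.

Section SecondDifferential.
Context {R : realType} {X : normedModType R[i]}.
Implicit Types (f : X -> X) (z : X) (T : X -> X -> X).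

(** The difference of the two candidates is o(|h|) and homogeneous in h,
    hence zero; this is tested on t x for a small t > 0. *)
Lemma second_diff_unique f z T1 T2 :
  is_second_diff f z T1 -> is_second_diff f z T2 -> T1 = T2.
Proof.
move=> [l1 _ _ H1] [l2 _ _ H2]; apply/funext => x; apply/funext => y.
apply/subr0_eq/eqP; rewrite -nrm_eq0 eq_le nrm_ge0 andbT.
apply/ler_addgt0Pr => e e0; rewrite add0r.
(* both estimates contribute e / K * |x| * |y| *)
pose K := 2 * (nrm x * nrm y + 1).
have K0 : 0 < K by rewrite mulr_gt0// ltr_wpDl// mulr_ge0 ?nrm_ge0.
have eK : 0 < e / K by rewrite divr_gt0.
have /nbhs_nrmP[d1 d10 {}H1] := H1 _ eK; have /nbhs_nrmP[d2 d20 {}H2] := H2 _ eK.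
pose d := Num.min d1 d2; have d0 : 0 < d by rewrite lt_min d10.
have x1 : 0 < nrm x + 1 by rewrite ltr_wpDl ?nrm_ge0.
pose t := d / 2 / (nrm x + 1).
have t0 : 0 < t by rewrite !divr_gt0.
have tx : nrm (t%:C *: x) = t * nrm x by rewrite nrmZ nrm_real gtr0_norm.
have txd : nrm (t%:C *: x - 0) < d.
  rewrite subr0 tx /t mulrAC ltr_pdivrMr//.
  by have := nrm_ge0 x; nra.
move: (txd); rewrite lt_min => /andP[/H1/(_ y) h1 /H2/(_ y) h2].
have lin T : (forall y, linear (T^~ y)) -> T (t%:C *: x) y = t%:C *: T x y.
  move=> lT; have /= L0 := lT y (-1) 0 0.
  have := lT y t%:C x 0; rewrite /= addr0 => ->.
  by move: L0; rewrite scaler0 addr0 scaleN1r addNr => ->; rewrite addr0.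
rewrite (lin _ l1) in h1; rewrite (lin _ l2) in h2; rewrite tx in h1 h2.
set D := _ - 'd f z y in h1 h2.
have : nrm (t%:C *: (T1 x y - T2 x y)) <= 2 * (e / K * (t * nrm x) * nrm y).
  have -> : t%:C *: (T1 x y - T2 x y) = (D - t%:C *: T2 x y) - (D - t%:C *: T1 x y).
    by rewrite scalerBr opprB [RHS]addrC addrA subrK.
  by rewrite (le_trans (nrmB _ _))// mulr_natl mulr2n lerD.
rewrite nrmZ nrm_real gtr0_norm//.
have -> : 2 * (e / K * (t * nrm x) * nrm y) = t * (2 * (e / K * (nrm x * nrm y))) by ring.
rewrite ler_pM2l// => /le_trans; apply.
have -> : 2 * (e / K * (nrm x * nrm y)) = e * ((2 * (nrm x * nrm y)) / K) by ring.
by rewrite ler_piMr ?(ltW e0)// ler_pdivrMr// mul1r /K; lra.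
Qed.

Lemma second_diffE f z T : is_second_diff f z T -> second_diff f z = T.
Proof.
move=> fT; apply: (second_diff_unique _ (fT)); rewrite /second_diff.
by apply: (@xgetPex _ _ [set T | is_second_diff f z T]); exists T.
Qed.

Lemma inv_diffE f z (Li : X -> X) v :
  (forall h, 'd f z (Li h) = h) -> (forall h, Li ('d f z h) = h) ->
  inv_diff f z v = Li v.
Proof.
move=> fL Lf; rewrite /inv_diff; case: xgetP => [w _ /= <-|/(_ (Li v)) /=].
  by rewrite Lf.
by rewrite fL.
Qed.

(** The chain rule applied to g \o f = id near [z]. *)
Lemma locally_biholomorphic_diff_inj f (A : set X) z h :
  locally_biholomorphic A f -> A z -> 'd f z h = 0 -> h = 0.
Proof.
move=> fA /fA[V [oV Vz _ [hf _ [g hg gf]]]] fh.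
have df := hf z Vz; have dg : differentiable g (f z) by apply: hg; exists z.
have gfz : forall k, 'd (g \o f) z k = k.
  apply: (@diff_nrm _ _ _ (g \o f) (fun k => k) z _ _ _).2 => //.
    by exists 1 => k; rewrite mul1r.
  move=> e e0; have /nbhs_nrmP[d d0 Vd] : nbhs z V by exact: open_nbhs_nbhs.
  apply/nbhs_nrmP; exists d => // k; rewrite subr0 => kd.
  have Vk : V (z + k) by apply: Vd; rewrite addrC addKr.
  by rewrite /= !gf// [z + k]addrC addrK subrr nrm0 mulr_ge0 ?nrm_ge0 ?ltW.
rewrite -(gfz h).
have -> : 'd (g \o f) z = 'd g (f z) \o 'd f z :> (X -> X) by exact: diff_comp.
by rewrite /= fh linear0.
Qed.

Lemma bilin_norm_le T (K : R) :
  (forall x y, nrm x = 1 -> nrm y = 1 -> nrm (T x y) <= K) ->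
  (bilin_norm T <= K%:E)%E.
Proof.
move=> TK; apply: ge_ereal_sup => _ [x [y [x1 y1 ->]]].
by rewrite lee_fin TK.
Qed.

Lemma nrm_le_bilin_norm T (K : R) x y :
  (bilin_norm T <= K%:E)%E -> nrm x = 1 -> nrm y = 1 -> nrm (T x y) <= K.
Proof.
move=> TK x1 y1; rewrite -lee_fin; apply: le_trans TK.
by apply: ereal_sup_ubound; exists x, y.
Qed.

End SecondDifferential.

Lemma common_radius (R : realType) (m : nat) (P : 'I_m -> R -> Prop) :
  (forall j d d', d' <= d -> P j d -> P j d') ->
  (forall j, exists2 d, 0 < d & P j d) ->
  exists2 d, 0 < d & forall j, P j d.
Proof.
move=> mono Pj.
have /choice[d dP] : forall j, exists d, 0 < d /\ P j d.
  by move=> j; have [d d0 Pd] := Pj j; exists d.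
exists (\big[Num.min/1]_j d j) => [|j].
  by elim/big_ind: _ => // [x y x0 y0|j _]; [rewrite lt_min x0|exact: (dP j).1].
by apply: mono (dP j).2; exact: bigmin_le.
Qed.

Lemma subr_add_cancel (V : zmodType) (x y a b c : V) :
  x + a - (y + b) - (x - y + c) = a - b - c.
Proof.
have -> : x + a - (y + b) = (x - y) + (a - b) by rewrite opprD addrACA.
by move: (x - y) => w; rewrite opprD addrACA subrr add0r.
Qed.

Section PhiDifferential.
Context {R : realType} {X : normedModType R[i]} (ip : {dot X for Num.conj}).
Hypothesis ip_norm : forall x : X, ip x x = `|x| ^+ 2.
Context {m : nat} (u : 'I_m -> X).
Hypothesis u_unit : forall j, `|u j| = 1.
Hypothesis u_orth : forall j k, j != k -> ip (u j) (u k) = 0.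
Local Notation C := R[i]^o.
Variable g : 'I_m -> C -> C.
Local Notation F := (Phi ip u g).
Local Notation p x j := (ip x (u j) : C).

Hypothesis g_derive : forall j (z : C), nrm z < 1 ->
  is_derive z 1 (g j) (derive1 (g j) z) /\
  is_derive z 1 (derive1 (g j)) (derive1n 2 (g j) z).

Definition dPhi (z : X) : X -> X := diag_op ip u (fun j => derive1 (g j) (p z j)).

Definition d2Phi (z x y : X) : X :=
  \sum_j (derive1n 2 (g j) (p z j) * p x j * p y j) *: u j.

Lemma ip_ball z j : nrm z < 1 -> nrm (p z j) < 1.
Proof. exact: (le_lt_trans (nrm_ip_le ip_norm u_unit u_orth z j)). Qed.

Lemma ip_ballB z (d : R) x j : nrm (x - z) < d -> nrm (p x j - p z j) < d.
Proof.
have -> : p x j - p z j = p (x - z) j by rewrite ipBl.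
exact: (le_lt_trans (nrm_ip_le ip_norm u_unit u_orth _ j)).
Qed.

Lemma natr1_gt0 : 0 < m%:R + 1 :> R.
Proof. by rewrite ltr_wpDl. Qed.

(** Phi x - Phi y - D(x - y) has coordinates
    g_j x_j - g_j y_j - g_j'(z_j) (x_j - y_j) and no component on the orthogonal
    complement, so the one-variable estimates add up. *)
Lemma Phi_strict_diff z : nrm z < 1 -> strict_diff F z (dPhi z).
Proof.
move=> z1 e e0; pose e' := e / (m%:R + 1).
have e'0 : 0 < e' by rewrite divr_gt0// natr1_gt0.
have [d d0 H] : exists2 d : R, 0 < d & forall j (a b : C),
    nrm (a - p z j) < d -> nrm (b - p z j) < d ->
    nrm (g j a - g j b - derive1 (g j) (p z j) * (a - b)) <= e' * nrm (a - b).
  apply: common_radius => [j d d' dd H a b ad bd|j].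
    by apply: H; [exact: lt_le_trans ad dd|exact: lt_le_trans bd dd].
  have z1j := ip_ball j z1.
  have := @is_derive_strict R (g j) (p z j) (1 - nrm (p z j)) _ _
    (g_derive j z1j).2 e' e'0.
  apply; first by rewrite subr_gt0.
  move=> w wz; apply: (g_derive j _).1.
  have -> : w = (w - p z j) + p z j by rewrite subrK.
  by rewrite (le_lt_trans (nrmD _ _))// -ltrBrDr.
exists d => // x y xd yd.
pose k j := g j (p x j) - g j (p y j) - derive1 (g j) (p z j) * (p x j - p y j).
have -> : F x - F y - dPhi z (x - y) = \sum_j k j *: u j.
  have FE w : F w = w + \sum_j (g j (p w j) - p w j) *: u j.
    rewrite /Phi -addrA; congr (_ + _); rewrite addrC -sumrB.
    by apply: eq_bigr => j _; rewrite scalerBl.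
  rewrite !FE /dPhi /diag_op subr_add_cancel.
  rewrite -!sumrB; apply: eq_bigr => j _; rewrite -!scalerBl; congr (_ *: _).
  by rewrite /k ipBl; ring.
have -> : e * nrm (x - y) = (m%:R + 1) * (e' * nrm (x - y)).
  by rewrite /e'; field; rewrite gt_eqF ?natr1_gt0.
apply: le_trans (nrm_comb_le u_unit (K := e' * nrm (x - y)) _) _.
  move=> j; rewrite /k (le_trans (H j _ _ (ip_ballB j xd) (ip_ballB j yd)))//.
  rewrite ler_wpM2l ?(ltW e'0)//.
  have -> : p x j - p y j = p (x - y) j by rewrite ipBl.
  exact: nrm_ip_le.
by rewrite ler_wpM2r ?lerDl// mulr_ge0 ?nrm_ge0 ?ltW.
Qed.

Lemma dPhi_linear z : linear (dPhi z).
Proof. exact: diag_op_linear. Qed.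

Lemma dPhi_bounded z : bounded_map (dPhi z).
Proof. exact: (diag_op_bounded ip_norm u_unit u_orth). Qed.

Lemma diff_Phi z h : nrm z < 1 -> 'd F z h = dPhi z h.
Proof.
move=> z1.
by have [_] := strict_diff_diff (dPhi_linear z) (dPhi_bounded z) (Phi_strict_diff z1).
Qed.

(** The coordinatewise estimate of [Phi_strict_diff], for the derivatives of
    the [g j] and with the extra factor y_j. *)
Lemma Phi_second_diff z : nrm z < 1 -> second_diff F z = d2Phi z.
Proof.
move=> z1; apply: second_diffE; split.
- move=> y k x x'; rewrite /d2Phi scaler_sumr -big_split /=.
  apply: eq_bigr => j _; rewrite scalerA -scalerDl ipDl ipZl; congr (_ *: _); ring.
- move=> x k y y'; rewrite /d2Phi scaler_sumr -big_split /=.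
  apply: eq_bigr => j _; rewrite scalerA -scalerDl ipDl ipZl; congr (_ *: _); ring.
- exists (\sum_j nrm (derive1n 2 (g j) (p z j))) => x y.
  rewrite (le_trans (nrm_sum _ _ _))// !mulr_suml; apply: ler_sum => j _.
  rewrite nrmZ (nrm_u u_unit) mulr1 !nrmM ler_pM ?mulr_ge0 ?nrm_ge0//.
    by rewrite ler_wpM2l ?nrm_ge0//; exact: nrm_ip_le.
  exact: nrm_ip_le.
move=> e e0; pose e' := e / (m%:R + 1).
have e'0 : 0 < e' by rewrite divr_gt0// natr1_gt0.
have [d d0 H] : exists2 d : R, 0 < d & forall j (a : C), nrm a < d ->
    nrm (derive1 (g j) (p z j + a) - derive1 (g j) (p z j)
      - a * derive1n 2 (g j) (p z j)) <= e' * nrm a.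
  apply: common_radius => [j d d' dd H a ad|j].
    by apply: H; exact: lt_le_trans ad dd.
  have /nbhs_nrmP[d d0 H] := is_derive_nrmP (g_derive j (ip_ball j z1)).2 e'0.
  by exists d => // a ad; apply: H; rewrite subr0.
apply/nbhs_nrmP; exists (Num.min d (1 - nrm z)) => [|h].
  by rewrite lt_min d0 subr_gt0.
rewrite subr0 lt_min => /andP[hd h1] y.
have zh1 : nrm (z + h) < 1 by rewrite (le_lt_trans (nrmD _ _))//; lra.
rewrite (diff_Phi _ zh1) (diff_Phi _ z1).
pose k j := (derive1 (g j) (p z j + p h j) - derive1 (g j) (p z j)
      - p h j * derive1n 2 (g j) (p z j)) * p y j.
have -> : dPhi (z + h) y - dPhi z y - d2Phi z h y = \sum_j k j *: u j.
  rewrite /dPhi /diag_op /d2Phi opprD addrACA subrr add0r -!sumrB.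
  apply: eq_bigr => j _; rewrite -!scalerBl; congr (_ *: _).
  rewrite /k (ipDl ip z h (u j)).
  have E (A B D a b : R[i]) : (A - 1 - (B - 1) - D * a) * b = (A - B - a * D) * b.
    by ring.
  exact: E.
have -> : e * nrm h * nrm y = (m%:R + 1) * (e' * nrm h * nrm y).
  by rewrite /e'; field; rewrite gt_eqF ?natr1_gt0.
apply: le_trans (nrm_comb_le u_unit (K := e' * nrm h * nrm y) _) _.
  move=> j; rewrite /k nrmM ler_pM ?nrm_ge0//; last exact: nrm_ip_le.
  have hj : nrm (p h j) <= nrm h by exact: nrm_ip_le.
  rewrite (le_trans (H j _ (le_lt_trans hj hd)))//.
  by rewrite ler_wpM2l ?(ltW e'0).
by rewrite ler_wpM2r ?lerDl// !mulr_ge0 ?nrm_ge0 ?ltW.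
Qed.

Lemma inv_diff_Phi z v : nrm z < 1 -> (forall j, derive1 (g j) (p z j) != 0) ->
  inv_diff F z v = diag_op ip u (fun j => (derive1 (g j) (p z j))^-1) v.
Proof.
move=> z1 g0; apply: inv_diffE => h; rewrite (diff_Phi _ z1) /dPhi diag_op_comp//.
  by apply: diag_op1 => j; rewrite mulfV.
by apply: diag_op1 => j; rewrite mulVf.
Qed.

Lemma inv_diff_second_diff_Phi z x y : nrm z < 1 ->
  (forall j, derive1 (g j) (p z j) != 0) ->
  inv_diff F z (second_diff F z x y) =
  \sum_j (derive1n 2 (g j) (p z j) / derive1 (g j) (p z j) * p x j * p y j) *: u j.
Proof.
move=> z1 g0; rewrite inv_diff_Phi// Phi_second_diff// diag_op_comb//.
by apply: eq_bigr => j _; congr (_ *: _); ring.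
Qed.

(** The differential of Phi multiplies [u j] by the derivative of [g j], and
    it is injective. *)
Lemma derive1_neq0_of_locally_biholomorphic z j :
  locally_biholomorphic (unit_ball X) F -> nrm z < 1 -> derive1 (g j) (p z j) != 0.
Proof.
move=> bF z1; apply/eqP => g0.
have Bz : unit_ball X z by exact/unit_ballE.
have /eqP : u j = 0.
  apply: (locally_biholomorphic_diff_inj bF Bz); rewrite diff_Phi//.
  rewrite /dPhi /diag_op (bigD1 j)//= big1 ?addr0 => [|k kj].
    by rewrite ip_u// eqxx g0 sub0r mulr1 scaleN1r subrr.
  by rewrite ip_u// eq_sym (negPf kj) mulr0 scale0r.
by rewrite -nrm_eq0 nrm_u// oner_eq0.
Qed.

End PhiDifferential.

Lemma Phi_locally_biholomorphic (R : realType) (X : completeNormedModType R[i])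
    (ip : {dot X for Num.conj}) (ip_norm : forall x : X, ip x x = `|x| ^+ 2)
    (m : nat) (u : 'I_m -> X) (u_unit : forall j, `|u j| = 1)
    (u_orth : forall j k, j != k -> ip (u j) (u k) = 0)
    (g : 'I_m -> R[i]^o -> R[i]^o) :
  (forall j (z : R[i]^o), nrm z < 1 -> [/\ is_derive z 1 (g j) (derive1 (g j) z),
    is_derive z 1 (derive1 (g j)) (derive1n 2 (g j) z) & derive1 (g j) z != 0]) ->
  locally_biholomorphic (unit_ball X) (Phi ip u g).
Proof.
move=> gP.
have g_derive j (z : R[i]^o) : nrm z < 1 -> is_derive z 1 (g j) (derive1 (g j) z) /\
    is_derive z 1 (derive1 (g j)) (derive1n 2 (g j) z).
  by move=> /(gP j)[].
pose Li z := diag_op ip u (fun j => (derive1 (g j) (ip z (u j)))^-1).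
apply: (@strict_diff_locally_biholomorphic _ _ _ _ (dPhi ip u g) Li).
- exact: open_unit_ball.
- move=> z /unit_ballE z1; split; [exact: Phi_strict_diff|exact: dPhi_linear|].
  exact: dPhi_bounded.
- move=> z _; split; first exact: diag_op_linear.
  exact: diag_op_bounded.
- move=> z /unit_ballE z1.
  have g0 j : derive1 (g j) (ip z (u j)) != 0.
    by have [] := gP j _ (ip_ball ip_norm u_unit u_orth j z1).
  split=> h; rewrite /Li /dPhi diag_op_comp//; apply: diag_op1 => j.
    by rewrite mulfV.
  by rewrite mulVf.
Qed.

(** * Membership in the classes *)

Section ExtremalFunctionClass.
Context {R : realType}.
Local Notation C := R[i]^o.
Variable alpha : R.
Hypothesis alpha_lt1 : alpha < 1.

Lemma mem_UE (z : C) : U z <-> nrm z < 1.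
Proof. exact: unit_ballE. Qed.

Lemma open_U : open (U : set C).
Proof. exact: open_unit_ball. Qed.

Lemma classHU_is_derive (f : C -> C) (z : C) : classHU f -> nrm z < 1 ->
  is_derive z 1 f (derive1 f z) /\
  is_derive z 1 (derive1 f) (derive1n 2 f z).
Proof. by move=> [fU _ _] /mem_UE; exact: analytic_is_derive open_U fU. Qed.

Lemma derive1_hfun (z : C) : nrm z < 1 -> derive1 (hfun alpha) z = hfun' alpha z.
Proof. by move=> z1; exact: derive1_val (is_derive_hfun alpha z1). Qed.

Lemma derive2_hfun (z : C) : nrm z < 1 ->
  derive1n 2 (hfun alpha) z = (2 - 2 * alpha)%:C / (1 - z) * hfun' alpha z.
Proof.
move=> z1; apply: derive1_val; apply: near_eq_is_derive (is_derive_hfun' alpha z1).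
have : nbhs z U by apply: open_nbhs_nbhs; split; [exact: open_U|exact/mem_UE].
by apply: filterS => w /mem_UE w1; rewrite derive1_hfun.
Qed.

Lemma derive1_hfun_neq0 (z : C) : nrm z < 1 -> derive1 (hfun alpha) z != 0.
Proof. by move=> z1; rewrite derive1_hfun// cexp_neq0. Qed.

Lemma hfun_pre_schwarzian (z : C) : nrm z < 1 ->
  derive1n 2 (hfun alpha) z / derive1 (hfun alpha) z = (2 - 2 * alpha)%:C / (1 - z).
Proof.
by move=> z1; rewrite derive2_hfun// derive1_hfun// mulfK// cexp_neq0.
Qed.

Lemma clog1 : clog (1 : C) = 0.
Proof.
rewrite /clog /carg normr1 /= lexx divr1 acos1 ln1.
by [].
Qed.

Lemma hfun_classHU : classHU (hfun alpha).
Proof.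
have n0 : nrm (0 : C) < 1 by rewrite nrm0.
split; first exact: hfun_analytic.
- rewrite /hfun /cpow !subr0 clog1 mulr0 cexp0 subrr mul0r oppr0.
  by case: ifP.
- by rewrite derive1_hfun// /hfun' subr0 clog1 mulr0 cexp0.
Qed.

(** With z = x + i y, the real part of 1 + (2 - 2 alpha) z / (1 - z) equals
    alpha + (1 - alpha) (1 - |z|^2) / |1 - z|^2. *)
Lemma hfun_classK : classK alpha (hfun alpha).
Proof.
split; first exact: hfun_classHU.
move=> z /mem_UE z1; split; first exact: derive1_hfun_neq0.
rewrite -mulrA hfun_pre_schwarzian//.
have n2 := nrm_sqr z; have n1 : nrm z ^+ 2 < 1.
  by rewrite expr_lt1// nrm_ge0.
have w0 := one_sub_neq0 z1.
rewrite n2 in n1; move: n1 w0 {z1 n2}; case: z => x y /= n1.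
rewrite eq_complex /= => w0.
have D0 : 0 < (1 - x) ^+ 2 + (0 - y) ^+ 2.
  rewrite lt_def addr_ge0 ?sqr_ge0// andbT paddr_eq0 ?sqr_ge0// !sqrf_eq0.
  exact: w0.
have E : 1 + (x * ((2 - 2 * alpha) * ((1 - x) / ((1 - x) ^+ 2 + (0 - y) ^+ 2))
    - 0 * - ((0 - y) / ((1 - x) ^+ 2 + (0 - y) ^+ 2))) -
  y * ((2 - 2 * alpha) * - ((0 - y) / ((1 - x) ^+ 2 + (0 - y) ^+ 2)) +
    0 * ((1 - x) / ((1 - x) ^+ 2 + (0 - y) ^+ 2)))) =
  alpha + (1 - alpha) * (1 - (x ^+ 2 + y ^+ 2)) / ((1 - x) ^+ 2 + (0 - y) ^+ 2).
  by field; apply/eqP => H; move: D0; lra.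
rewrite E.
by rewrite ltrDl divr_gt0// mulr_gt0// subr_gt0.
Qed.

End ExtremalFunctionClass.

Section MainParts.
Context {R : realType} {X : completeNormedModType R[i]} (ip : {dot X for Num.conj}).
Hypothesis ip_norm : forall x : X, ip x x = `|x| ^+ 2.
Context {m : nat} (u : 'I_m -> X).
Hypothesis u_unit : forall j, `|u j| = 1.
Hypothesis u_orth : forall j k, j != k -> ip (u j) (u k) = 0.
Local Notation C := R[i]^o.
Variable alpha : R.
Hypothesis alpha_lt1 : alpha < 1.
Variable g : 'I_m -> C -> C.
Hypothesis gH : forall j, classHU (g j).

Let g_derive j (z : C) : nrm z < 1 -> is_derive z 1 (g j) (derive1 (g j) z) /\
    is_derive z 1 (derive1 (g j)) (derive1n 2 (g j) z).
Proof. exact: classHU_is_derive. Qed.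

Lemma ip_scale_u (a : C) j k : ip (a *: u j) (u k) = a * (j == k)%:R.
Proof. by rewrite ipZl ip_u. Qed.

Lemma nrm_scale_u (a : C) j : nrm (a *: u j) = nrm a.
Proof. by rewrite nrmZ nrm_u// mulr1. Qed.

Lemma derive1_neq0_of_Phi j (xi : C) :
  locally_biholomorphic (unit_ball X) (Phi ip u g) -> nrm xi < 1 ->
  derive1 (g j) xi != 0.
Proof.
move=> bF xi1.
have := derive1_neq0_of_locally_biholomorphic ip_norm u_unit u_orth g_derive j bF
  (_ : nrm (xi *: u j) < 1).
by rewrite ip_scale_u eqxx mulr1 nrm_scale_u; apply.
Qed.

(** Tested at z = xi u_j and x = i xi u_j: the square of x_j contributes the
    factor -xi^2, which reverses the sign of the second-order term. *)
Lemma classK_of_classKB j : classKB ip alpha (Phi ip u g) -> classK alpha (g j).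
Proof.
move=> [[bF cF] _]; split; first exact: gH.
move=> xi /mem_UE xi1; split; first exact: derive1_neq0_of_Phi.
have [->|xi0] := eqVneq xi 0; first by rewrite !mul0r addr0.
have n0 : 0 < nrm xi by rewrite nrm_gt0.
pose z := xi *: u j; pose x := ('i%C * xi) *: u j.
have z1 : nrm z < 1 by rewrite nrm_scale_u.
have ni : nrm ('i%C : C) = 1 by rewrite /nrm normc_def /= expr0n expr1n add0r sqrtr1.
have nx : nrm x = nrm xi by rewrite nrm_scale_u nrmM ni mul1r.
have xz : complex.Re (ip x z) = 0.
  rewrite ipZl (ipC ip z) ipZl ip_u// eqxx mulr1.
  by case: (xi) => a b /=; ring.
have zn0 : z != 0 by rewrite -nrm_eq0 nrm_scale_u gt_eqF.
have xn0 : x != 0 by rewrite -nrm_eq0 nx gt_eqF.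
have := cF z x ((unit_ballE z).2 z1) zn0 xn0 xz.
have g0 k : derive1 (g k) (ip z (u k)) != 0.
  exact: derive1_neq0_of_locally_biholomorphic.
rewrite inv_diff_second_diff_Phi// ip_comb_l (bigD1 j)//= big1 ?addr0 => [|k kj].
  rewrite !ip_scale_u eqxx !mulr1 nx.
  set q : C := _ / _.
  have -> : xi * derive1n 2 (g j) xi / derive1 (g j) xi = xi * q by rewrite mulrA.
  have n2 := nrm_sqr xi.
  have -> : complex.Re (q * ('i%C * xi) * ('i%C * xi) * xi^*%C) =
    - (nrm xi ^+ 2 * complex.Re (xi * q)).
    by rewrite n2; case: (q) (xi) => [a b] [c d] /=; ring.
  have n20 : 0 < nrm xi ^+ 2 by rewrite exprn_gt0.
  have -> : complex.Re (1 + xi * q) = 1 + complex.Re (xi * q) by case: (xi * q).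
  rewrite opprK mulrC -[X in _ < X + _]mulr1 -mulrDr ltr_pM2l//.
by rewrite !ip_scale_u eq_sym (negPf kj) !mulr0 mul0r.
Qed.

(** At z = xi u_j and x = y = u_j the bilinear map returns q_j(xi) u_j. *)
Lemma classSKU_of_classSKB j : classSKB alpha (Phi ip u g) -> classSKU alpha (g j).
Proof.
move=> [[bF _] bT]; split; first exact: gH.
move=> xi /mem_UE xi1; split; first exact: derive1_neq0_of_Phi.
pose z := xi *: u j.
have z1 : nrm z < 1 by rewrite nrm_scale_u.
have g0 k : derive1 (g k) (ip z (u k)) != 0.
  exact: derive1_neq0_of_locally_biholomorphic.
have nu := nrm_u u_unit j.
have := nrm_le_bilin_norm (bT z ((unit_ballE z).2 z1)) nu nu.
rewrite inv_diff_second_diff_Phi// (bigD1 j)//= big1 ?addr0 => [|k kj].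
  by rewrite ip_scale_u ip_u// eqxx !mulr1 nrm_scale_u.
by rewrite ip_u// eq_sym (negPf kj) mulr0 scale0r.
Qed.

Lemma Phi_normalized : is_normalized (Phi ip u g).
Proof.
split=> [|x].
  rewrite /Phi !big1 ?subr0 ?addr0// => j _; rewrite ip0l ?scale0r//.
  by have [_ -> _] := gH j; rewrite scale0r.
rewrite (@diff_Phi _ _ _ ip_norm _ _ u_unit u_orth g g_derive) ?nrm0//.
by apply: diag_op1 => j; rewrite ip0l; have [] := gH j.
Qed.

(** |x_j| <= |x| reduces the sum of |q_j x_j y_j|^2 to the sum of |y_j|^2,
    which Bessel's inequality bounds. *)
Lemma classSKB_of_classSKU :
  (forall j, classSKU alpha (g j)) -> classSKB alpha (Phi ip u g).
Proof.
move=> gS.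
have g0 j (z : C) : nrm z < 1 -> derive1 (g j) z != 0.
  by move=> z1; have [_ /(_ z)] := gS j; rewrite mem_UE => /(_ z1)[].
split; first split.
- apply: (Phi_locally_biholomorphic ip_norm u_unit u_orth) => j z z1.
  by have [d1 d2] := g_derive j z1; split; [exact: d1|exact: d2|exact: g0].
- exact: Phi_normalized.
move=> z /unit_ballE z1; apply: bilin_norm_le => x y x1 y1.
have zj j := ip_ball ip_norm u_unit u_orth j z1.
rewrite inv_diff_second_diff_Phi//; last by move=> j; exact: g0.
have a1 : 0 <= 1 - alpha by rewrite subr_ge0 ltW.
rewrite -ler_sqr ?nnegrE ?nrm_ge0// (nrm2_comb ip_norm u_unit u_orth).
have y2 := bessel ip_norm u_unit u_orth y; rewrite y1 expr1n in y2.

have -> : (1 - alpha) ^+ 2 = (1 - alpha) ^+ 2 * 1 by rewrite mulr1.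
apply: le_trans (ler_wpM2l (sqr_ge0 _) y2); rewrite mulr_sumr.
apply: ler_sum => j _; rewrite nrmM exprMn ler_wpM2r ?sqr_ge0//.
rewrite ler_sqr ?nnegrE ?nrm_ge0// nrmM -[leRHS]mulr1.
apply: ler_pM; rewrite ?nrm_ge0//.
  by have [_ /(_ (ip z (u j)))] := gS j; rewrite mem_UE => /(_ (zj j))[].
by rewrite -x1; exact: nrm_ip_le.
Qed.

Let convexity_violated : alpha * 2 < 2 - (2 - 2 * alpha + (2 - 2 * alpha)) -> False.
Proof. by have := alpha_lt1; lra. Qed.

(** At z = (u_0 + u_1) / 2 and x = u_0 - u_1 the second-order term is
    4 - 4 alpha, while |x|^2 = 2, so the convexity inequality would read
    2 alpha < 4 alpha - 2. *)
Lemma hfun_not_classKB : (2 <= m)%N ->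
  ~ classKB ip alpha (Phi ip u (fun=> hfun alpha)).
Proof.
move=> m2 [[bF cF] _].
pose i0 : 'I_m := Ordinal (ltnW m2); pose i1 : 'I_m := Ordinal m2.
have i01 : i0 != i1 by [].
pose a k : C := 2^-1 * (k == i0)%:R + 2^-1 * (k == i1)%:R.
pose b k : C := (k == i0)%:R - (k == i1)%:R.
have a0 : a i0 = 2^-1 by rewrite /a eqxx (negPf i01) mulr1 mulr0 addr0.
have a1 : a i1 = 2^-1 by rewrite /a eqxx eq_sym (negPf i01) mulr1 mulr0 add0r.
have b0 : b i0 = 1 by rewrite /b eqxx (negPf i01) subr0.
have b1 : b i1 = -1 by rewrite /b eqxx eq_sym (negPf i01) sub0r.
have sum2 (V : zmodType) (f : 'I_m -> V) :
    (forall k, k != i0 -> k != i1 -> f k = 0) -> \sum_k f k = f i0 + f i1.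
  move=> f0; rewrite (bigD1 i0)//= (bigD1 i1) 1?eq_sym//= big1 ?addr0//.
  by move=> k /andP[]; exact: f0.
have ak0 k : k != i0 -> k != i1 -> a k = 0.
  by move=> /negPf k0 /negPf k1; rewrite /a k0 k1 !mulr0 addr0.
have bk0 k : k != i0 -> k != i1 -> b k = 0.
  by move=> /negPf k0 /negPf k1; rewrite /b k0 k1 subr0.
pose z := \sum_k a k *: u k; pose x := \sum_k b k *: u k.
have pz k : ip z (u k) = a k by exact: ip_comb.
have px k : ip x (u k) = b k by exact: ip_comb.
have nh : nrm (2^-1 : C) = 2^-1 by rewrite nrmV nrm_nat.
have nz : nrm z ^+ 2 = 2^-1.
  rewrite (nrm2_comb ip_norm u_unit u_orth) sum2 => [|k k0 k1];
    last by rewrite ak0// nrm0 expr0n.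
  by rewrite a0 a1 nh; lra.
have z1 : nrm z < 1.
  by rewrite -(expr_lt1 (n := 2))// ?nrm_ge0// nz invf_lt1// ltr1n.
have nx : nrm x ^+ 2 = 2.
  rewrite (nrm2_comb ip_norm u_unit u_orth) sum2 => [|k k0 k1];
    last by rewrite bk0// nrm0 expr0n.
  by rewrite b0 b1 nrmN nrm1 expr1n.
have zn0 : z != 0.
  apply/eqP => E; move: nz; rewrite E nrm0 expr0n /= => /esym/eqP.
  by rewrite invr_eq0 pnatr_eq0.
have xn0 : x != 0.
  apply/eqP => E; move: nx; rewrite E nrm0 expr0n /= => /esym/eqP.
  by rewrite pnatr_eq0.
have xz : ip x z = 0.
  rewrite {1}/x ip_comb_l sum2 => [|k k0 k1]; last by rewrite bk0// mul0r.
  by rewrite !pz a0 a1 b0 b1 mul1r mulN1r subrr.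
have hd (j : 'I_m) (w : C) : nrm w < 1 ->
    is_derive w 1 (hfun alpha) (derive1 (hfun alpha) w) /\
    is_derive w 1 (derive1 (hfun alpha)) (derive1n 2 (hfun alpha) w).
  by apply: classHU_is_derive; exact: hfun_classHU.
have := cF z x ((unit_ballE z).2 z1) zn0 xn0; rewrite xz => /(_ erefl).
have h0 k : derive1 (hfun alpha) (ip z (u k)) != 0.
  by apply: derive1_hfun_neq0; exact: ip_ball.
rewrite (@inv_diff_second_diff_Phi _ _ _ ip_norm _ _ u_unit u_orth
  (fun=> hfun alpha) hd)// ip_comb_l//.
rewrite sum2 => [|k k0 k1]; last by rewrite px bk0// mulr0 mul0r.
rewrite !pz !px a0 a1 b0 b1 hfun_pre_schwarzian ?nh ?invf_lt1 ?ltr1n//.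
rewrite !mulrN1 opprK !mulr1 nx.
have -> : (2 - 2 * alpha)%:C / (1 - 2^-1) * (2^-1)^*%C = (2 - 2 * alpha)%:C.
  have h2 : 1 - 2^-1 = 2^-1 :> R[i] by field.
  by rewrite h2 conjc_inv conjc_nat divfK ?invr_eq0 ?pnatr_eq0.
rewrite -rmorphD /=; exact: convexity_violated.
Qed.

End MainParts.

Theorem theorem5 (R : realType) (X : completeNormedModType R[i])
    (ip : {dot X for Num.conj})
    (ip_norm : forall x : X, ip x x = `|x| ^+ 2)
    (m : nat) (m_ge2 : (2 <= m)%N) (dimX : dim_ge X m)
    (u : 'I_m -> X)
    (u_unit : forall j, `|u j| = 1)
    (u_orth : forall j k, j != k -> ip (u j) (u k) = 0)
    (alpha : R) (alpha_ge0 : 0 <= alpha) (alpha_lt1 : alpha < 1)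
    (g : 'I_m -> R[i]^o -> R[i]^o)
    (gH : forall j, classHU (g j))
    (g_univ : forall j, locally_univalent U (g j)) :
  [/\ classKB ip alpha (Phi ip u g) -> forall j, classK alpha (g j),
      classK alpha (hfun alpha) /\
        ~ classKB ip alpha (Phi ip u (fun _ => hfun alpha)) &
      classSKB alpha (Phi ip u g) <-> forall j, classSKU alpha (g j)].
Proof.
split.
- by move=> FK j; exact: classK_of_classKB FK.
- by split; [exact: hfun_classK|exact: hfun_not_classKB].
- split; first by move=> FS j; exact: classSKU_of_classSKB FS.
  exact: classSKB_of_classSKU.
Qed.
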